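(* Let $(\mathcal{G},X,T)$ be a decomposed graph of groups without circuit. Let $g$ and $x$ be nontrivial elements of $\pi_1(\mathcal{G},X)$. If $x$ is a root of $g$ (i.e. $x^n=g$ for some nonzero integer $n$), then either $x$ and $g$ are in a same conjugate of a vertex subgroup, or $x$ is in the infinite cyclic subgroup $\mathcal{Z}(g)$, the centralizer of $g$ in $\pi_1(\mathcal{G},X)$. In particular, $\pi_1(\mathcal{G},X)$ has trivial root structure if and only if all its vertex groups have trivial root structure.
   Context: A group $G$ has trivial root structure (SRT) if for every $g\in G$, the set $\{x\in G:\exists n\in\mathbb{Z}\setminus\{0\},\ x^n=g\}$ is contained in a cyclic subgroup. A finite graph $X$ consists of finite sets $\mathcal{A}_X$ (edges) and $\mathcal{S}_X$ (vertices), a fixed-point-free involution $a\mapsto -a$ of $\mathcal{A}_X$, and maps $\mathrm{o},\mathrm{e}:\mathcal{A}_X\to\mathcal{S}_X$ (origin, end) with $\mathrm{e}(a)=\mathrm{o}(-a)$. An orientation is a subset $\mathcal{A}_X^+\subset\mathcal{A}_X$ containing exactly one of $a,-a$ for each $a$. A graph of groups $(\mathcal{G},X)$ is a finite connected oriented graph $X$ with vertex groups $G_s$ ($s\in\mathcal{S}_X$), edge groups $G_a$ ($a\in\mathcal{A}_X^+$), and monomorphisms $f_a:G_a\to G_{\mathrm{o}(a)}$, $f_{-a}:G_a\to G_{\mathrm{e}(a)}$ for $a\in\mathcal{A}_X^+$. A decomposed graph of groups $(\mathcal{G},X,T)$ is a graph of groups together with a maximal tree $T$ of $X$. Its fundamental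 group $\pi_1(\mathcal{G},X)$ is the quotient of the free product of all $G_s$ and the free group on $\{t_a: a\in\mathcal{A}_X\}$ by the relations $f_a(h)=t_af_{-a}(h)t_a^{-1}$ ($a\in\mathcal{A}_X^+$, $h\in G_a$), $t_{-a}=t_a^{-1}$ ($a\in\mathcal{A}_X$), $t_a=1$ ($a\in\mathcal{A}_T$). Each $G_s$ embeds naturally in $\pi_1(\mathcal{G},X)$ and is identified with its image (a vertex subgroup). For $a\in\mathcal{A}_X^+$, put $G_a^-=f_a(G_a)\subset G_{\mathrm{o}(a)}$, $G_a^+=f_{-a}(G_a)\subset G_{\mathrm{e}(a)}$ (as subgroups of $\pi_1(\mathcal{G},X)$), and $\varphi_a=f_{-a}\circ f_a^{-1}:G_a^-\to G_a^+$; also $G_{-a}^{\mp}=G_a^{\pm}$ and $\varphi_{-a}=\varphi_a^{-1}$. Circuits. Let $u\in G_s$. A circuit at $u$ with origin $s$ consists of: a closed path $(a_1,\dots,a_n)$ in $X$, $n\ge0$, from $s_0=s$ to $s_n=s$ (with $s_i=\mathrm{e}(a_i)=\mathrm{o}(a_{i+1})$ for $0<i<n$; if $n=0$ the path is the single vertex $s$); elements $c_i^-\in G_{a_i}^-$, $c_i^+\in G_{a_i}^+$ with $c_i^+=\varphi_{a_i}(c_i^-)$, $i=1,\dots,n$; and elements $h_i\in G_{s_i}$, $i=0,\dots,n$, such that, if $n=0$, $u=h_0uh_0^{-1}$, and if $n\ge1$, $u=h_0c_1^-h_0^{-1}$, $c_i^+=h_ic_{i+1}^-h_i^{-1}$ for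 $1\le i\le n-1$, and $c_n^+=h_nuh_n^{-1}$. The circuit is trivial if $n=0$. It is reduced if there is no index $1\le i\le n-1$ with $a_{i+1}=-a_i$ and $h_i\in G_{a_i}^+$. The graph of groups is without circuit if for every $u\neq1$ (in a vertex subgroup), every reduced circuit at $u$ is trivial.
   Formalization: The final equivalence fails for g = 1 (e.g. Z/2 * Z/2); it is proved with root structure required only for g ≠ 1, and, with the literal definition, when all vertex groups are torsion-free; the literal ''only if'' direction is proved in general. *)

(* Defs.v *)
From HB Require Import structures.
From mathcomp Require Import all_boot ssrint.
From mathcomp Require Import generic_quotient.
From mathcomp Require Import boolp classical_sets.

Set Implicit Arguments.
Unset Strict Implicit.
Unset Printing Implicit Defensive.

Local Open Scope group_scope.
Local Open Scope classical_set_scope.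
Local Open Scope quotient_scope.

(* Groups are arbitrary, possibly infinite; the choice structure carried by   *)
(* groupType is no restriction in the presence of boolp.                      *)

Definition expgz (G : groupType) (x : G) (n : int) : G :=
  match n with
  | Posz m => x ^+ m
  | Negz m => x ^- m.+1
  end.

Definition cyclic_subgroup (G : groupType) (z : G) : set G :=
  [set y | exists k : int, y = expgz z k].

Definition centralizer (G : groupType) (g : G) : set G :=
  [set y | y * g = g * y].

Definition infinite_cyclic (G : groupType) (H : set G) : Prop :=
  exists2 z : G, injective (expgz z) & H = cyclic_subgroup z.

Definition conjugate_of (G : groupType) (y : G) (H : set G) : set G :=
  [set x | exists2 h, H h & x = y * h * y^-1].

Definition is_root (G : groupType) (x g : G) : Prop :=
  exists2 n : int, n <> Posz 0 & expgz x n = g.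

Definition roots_in_cyclic (G : groupType) (g : G) : Prop :=
  exists z : G, [set x | is_root x g] `<=` cyclic_subgroup z.

Definition trivial_root_structure (G : groupType) : Prop :=
  forall g : G, roots_in_cyclic g.

(* The instance g = 1 of trivial_root_structure says that the torsion         *)
(* elements of G lie in a single cyclic subgroup.  That condition is not      *)
(* inherited by free products: Z/2 has it, Z/2 * Z/2 does not.                *)
Definition trivial_root_structure_neq1 (G : groupType) : Prop :=
  forall g : G, g <> 1 -> roots_in_cyclic g.

Definition torsion_free (G : groupType) : Prop :=
  forall (x : G) (n : nat), (0 < n)%N -> x ^+ n = 1 -> x = 1.

Record graph := Graph {
  vertex : finType;
  edge : finType;
  opp : edge -> edge;
  origin : edge -> vertex;
  oppK : involutive opp;
  opp_neq : forall a, opp a != a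
}.

Definition terminus (X : graph) (a : edge X) : vertex X := origin (opp a).

Definition orientation (X : graph) (P : {set edge X}) : Prop :=
  forall a, (a \in P) = (opp a \notin P).

Fixpoint walk (X : graph) (s : vertex X) (p : seq (edge X)) (t : vertex X) :
    bool :=
  if p is a :: p' then (origin a == s) && walk (terminus a) p' t else s == t.

Definition reduced_walk (X : graph) (p : seq (edge X)) : bool :=
  sorted (fun a b => b != opp a) p.

Definition connected (X : graph) : Prop :=
  forall s t : vertex X, exists p, walk s p t.

Record subgraph (X : graph) := Subgraph {
  sub_vertex : {set vertex X};
  sub_edge : {set edge X};
  sub_opp : forall a, a \in sub_edge -> opp a \in sub_edge;
  sub_origin : forall a, a \in sub_edge -> origin a \in sub_vertex
}.

Definition is_tree (X : graph) (T : subgraph X) : Prop :=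
  [/\ exists s, s \in sub_vertex T,
      forall s t, s \in sub_vertex T -> t \in sub_vertex T ->
        exists2 p, walk s p t & all [in sub_edge T] p
    & forall s p, s \in sub_vertex T -> walk s p s -> all [in sub_edge T] p ->
        reduced_walk p -> p = [::]].

Definition maximal_tree (X : graph) (T : subgraph X) : Prop :=
  is_tree T /\
  forall T' : subgraph X, is_tree T' ->
    sub_vertex T \subset sub_vertex T' -> sub_edge T \subset sub_edge T' ->
    sub_vertex T' = sub_vertex T /\ sub_edge T' = sub_edge T.

(* mono_o a and mono_e a are the monomorphisms f_a and f_{-a} attached to a   *)
(* positive edge a.                                                           *)
Record graph_of_groups := GraphOfGroups {
  base :> graph;
  base_connected : connected base;
  positive : {set edge base};
  positive_orientation : orientation positive;
  vgroup : vertex base -> groupType;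
  egroup : {a : edge base | a \in positive} -> groupType;
  mono_o : forall a, {multiplicative egroup a -> vgroup (origin (val a))};
  mono_e : forall a, {multiplicative egroup a -> vgroup (terminus (val a))};
  mono_o_inj : forall a, injective (mono_o a);
  mono_e_inj : forall a, injective (mono_e a)
}.

(* The quotient of the free product of the vertex groups and of the free      *)
(* group on the t_a is given by its monoid presentation: words on the         *)
(* elements of the vertex groups and on the symbols t_a^{+1}, t_a^{-1},       *)
(* modulo the congruence generated by the relations of the free product and   *)
(* those of the fundamental group.                                            *)
Section FundamentalGroup.
Variables (GG : graph_of_groups) (T : subgraph GG).

Definition letter : Type := ({s : vertex GG & vgroup s} + edge GG * bool)%type.

Definition lv (s : vertex GG) (x : vgroup s) : letter :=
  inl (Tagged (fun s => vgroup s) x).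
Definition lt (a : edge GG) : letter := inr (a, true).
Definition ltV (a : edge GG) : letter := inr (a, false).

Inductive relation : seq letter -> seq letter -> Prop :=
| rel_mul s (x y : vgroup s) : relation [:: lv x; lv y] [:: lv (x * y)]
| rel_one s : relation [:: lv (1 : vgroup s)] [::]
| rel_tV a : relation [:: lt a; ltV a] [::]
| rel_Vt a : relation [:: ltV a; lt a] [::]
| rel_edge a (h : egroup a) :
    relation [:: lv (mono_o a h)]
             [:: lt (val a); lv (mono_e a h); ltV (val a)]
| rel_opp a : relation [:: lt (opp a)] [:: ltV a]
| rel_tree a : a \in sub_edge T -> relation [:: lt a] [::].

Inductive word_eq : seq letter -> seq letter -> Prop :=
| word_eq_rel u v w w' : relation w w' -> word_eq (u ++ w ++ v) (u ++ w' ++ v)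
| word_eq_refl w : word_eq w w
| word_eq_sym w w' : word_eq w w' -> word_eq w' w
| word_eq_trans w1 w2 w3 : word_eq w1 w2 -> word_eq w2 w3 -> word_eq w1 w3.

Definition word_eqb (u v : seq letter) : bool := `[< word_eq u v >].

Lemma word_eqb_refl : reflexive word_eqb.
Proof. by move=> w; apply/asboolP/word_eq_refl. Qed.

Lemma word_eqb_sym : symmetric word_eqb.
Proof. by move=> u v; apply/asboolP/asboolP; apply: word_eq_sym. Qed.

Lemma word_eqb_trans : transitive word_eqb.
Proof.
by move=> v u w /asboolP uv /asboolP vw; apply/asboolP/(word_eq_trans uv vw).
Qed.

Canonical word_equiv := EquivRel word_eqb word_eqb_refl word_eqb_sym
  word_eqb_trans.

Definition fundamental_group : Type := {eq_quot word_equiv}.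

HB.instance Definition _ := Choice.on fundamental_group.
HB.instance Definition _ := EqQuotient.on fundamental_group.

Definition word_class (w : seq letter) : fundamental_group :=
  \pi_fundamental_group w.

Lemma word_classP u v : word_class u = word_class v <-> word_eq u v.
Proof.
split=> [uv|uv]; first by apply/asboolP; apply/(@eqquotP _ word_equiv); exact: uv.
by apply/(@eqquotP _ word_equiv); apply/asboolP.
Qed.

Lemma word_class_repr (x : fundamental_group) : word_class (repr x) = x.
Proof. exact: reprK. Qed.

Lemma repr_word_class w : word_eq (repr (word_class w)) w.
Proof. by apply/word_classP; rewrite word_class_repr. Qed.

Lemma word_eq_ctx p q u v : word_eq u v -> word_eq (p ++ u ++ q) (p ++ v ++ q).
Proof.
elim=> {u v} [u v w w' r|w|w w' _|w1 w2 w3 _ h1 _ h2].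
- have e z : p ++ (u ++ z ++ v) ++ q = (p ++ u) ++ z ++ (v ++ q).
    by rewrite !catA.
  by rewrite !e; apply: word_eq_rel.
- exact: word_eq_refl.
- exact: word_eq_sym.
- exact: word_eq_trans h1 h2.
Qed.

Lemma word_eq_cat u u' v v' :
  word_eq u u' -> word_eq v v' -> word_eq (u ++ v) (u' ++ v').
Proof.
move=> hu hv; apply: (@word_eq_trans _ (u' ++ v)).
  exact: (@word_eq_ctx [::] v u u' hu).
by have := @word_eq_ctx u' [::] v v' hv; rewrite !cats0.
Qed.

Definition letter_inv (l : letter) : letter :=
  match l with
  | inl x => lv (tagged x)^-1
  | inr (a, b) => inr (a, ~~ b)
  end.

Definition word_inv (w : seq letter) : seq letter := rev (map letter_inv w).

Lemma letter_mulV l : word_eq [:: l; letter_inv l] [::].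
Proof.
have step w w' : relation w w' -> word_eq w w'.
  by move=> /(@word_eq_rel [::] [::]); rewrite /= !cats0.
case: l => [[s x]|[a []]] /=; [|exact/step/rel_tV|exact/step/rel_Vt].
apply: (@word_eq_trans _ [:: lv (x * x^-1)]); first exact/step/rel_mul.
by rewrite mulgV; exact/step/rel_one.
Qed.

Lemma letter_invK l : letter_inv (letter_inv l) = l.
Proof. by case: l => [[s x]|[a b]] /=; rewrite /lv /= ?invgK ?negbK. Qed.

Lemma word_mulV w : word_eq (w ++ word_inv w) [::].
Proof.
elim: w => [|l w IHw]; first exact: word_eq_refl.
rewrite /word_inv /= rev_cons -cats1 -/(word_inv w).
apply: (word_eq_trans _ (letter_mulV l)).
by have := word_eq_ctx [:: l] [:: letter_inv l] IHw; rewrite /= !catA.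
Qed.

Lemma word_invK w : word_inv (word_inv w) = w.
Proof.
by rewrite /word_inv map_rev revK -map_comp map_id_in // => l _ /=;
  rewrite letter_invK.
Qed.

Lemma word_mulVl w : word_eq (word_inv w ++ w) [::].
Proof. by have := word_mulV (word_inv w); rewrite word_invK. Qed.

Lemma word_eq_inv u v : word_eq u v -> word_eq (word_inv u) (word_inv v).
Proof.
move=> uv; apply: (@word_eq_trans _ (word_inv u ++ u ++ word_inv v)).
  apply: word_eq_sym; rewrite -[X in word_eq _ X]cats0.
  apply: word_eq_cat; first exact: word_eq_refl.
  apply: word_eq_trans (word_mulV v).
  by apply: word_eq_cat => //; exact: word_eq_refl.
rewrite catA -[X in word_eq _ X]cat0s.
apply: word_eq_cat; [exact: word_mulVl|exact: word_eq_refl].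
Qed.

Definition fg_mul (x y : fundamental_group) := word_class (repr x ++ repr y).
Definition fg_one := word_class [::].
Definition fg_inv (x : fundamental_group) := word_class (word_inv (repr x)).

Lemma fg_mulE u v : fg_mul (word_class u) (word_class v) = word_class (u ++ v).
Proof. by apply/word_classP; apply: word_eq_cat; apply: repr_word_class. Qed.

Lemma fg_invE u : fg_inv (word_class u) = word_class (word_inv u).
Proof. by apply/word_classP; apply/word_eq_inv/repr_word_class. Qed.

Lemma fg_mulA : associative fg_mul.
Proof.
move=> x y z; rewrite -[x]word_class_repr -[y]word_class_repr.
by rewrite -[z]word_class_repr !fg_mulE catA.
Qed.

Lemma fg_mul1 : left_id fg_one fg_mul.
Proof. by move=> x; rewrite -[x]word_class_repr fg_mulE. Qed.

Lemma fg_mulr1 : right_id fg_one fg_mul.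
Proof. by move=> x; rewrite -[x]word_class_repr fg_mulE cats0. Qed.

Lemma fg_mulVx : left_inverse fg_one fg_inv fg_mul.
Proof.
move=> x; rewrite -[x]word_class_repr fg_invE fg_mulE.
exact/word_classP/word_mulVl.
Qed.

Lemma fg_mulxV : right_inverse fg_one fg_inv fg_mul.
Proof.
move=> x; rewrite -[x]word_class_repr fg_invE fg_mulE.
exact/word_classP/word_mulV.
Qed.

HB.instance Definition _ := isGroup.Build fundamental_group
  fg_mulA fg_mul1 fg_mulr1 fg_mulVx fg_mulxV.

Definition vertex_map (s : vertex GG) (x : vgroup s) : fundamental_group :=
  word_class [:: lv x].

Definition vertex_subgroup (s : vertex GG) : set fundamental_group :=
  range (@vertex_map s).

(* edge_iso a is the graph of phi_a : G_a^- -> G_a^+, where                   *)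
(* phi_a = f_{-a} o f_a^{-1} if a is positive and phi_{-a} = phi_a^{-1}.      *)
Inductive edge_iso : edge GG -> fundamental_group -> fundamental_group -> Prop :=
| edge_iso_pos a (k : egroup a) :
    edge_iso (val a) (vertex_map (mono_o a k)) (vertex_map (mono_e a k))
| edge_iso_neg a (k : egroup a) :
    edge_iso (opp (val a)) (vertex_map (mono_e a k)) (vertex_map (mono_o a k)).

Definition edge_subgroup_minus (a : edge GG) : set fundamental_group :=
  [set x | exists y, edge_iso a x y].
Definition edge_subgroup_plus (a : edge GG) : set fundamental_group :=
  [set y | exists x, edge_iso a x y].

(* With the path p = (a_1, ..., a_n), circ_minus i and circ_plus i stand for  *)
(* c_{i+1}^- and c_{i+1}^+, indices in 'I_n starting at 0; circ_h i is h_i.   *)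
(* s_i is the i-th vertex of s_0 = s, e(a_1), ..., e(a_n).                    *)
Definition walk_vertex (s : vertex GG) (p : seq (edge GG)) (i : nat) :
    vertex GG :=
  nth s (s :: [seq terminus a | a <- p]) i.

Record circuit (u : fundamental_group) (s : vertex GG) := Circuit {
  circ_len : nat;
  circ_edge : circ_len.-tuple (edge GG);
  circ_minus : 'I_circ_len -> fundamental_group;
  circ_plus : 'I_circ_len -> fundamental_group;
  circ_h : 'I_circ_len.+1 -> fundamental_group;
  circ_walk : walk s circ_edge s;
  circ_iso : forall i,
    edge_iso (tnth circ_edge i) (circ_minus i) (circ_plus i);
  circ_hP : forall i : 'I_circ_len.+1,
    vertex_subgroup (walk_vertex s circ_edge i) (circ_h i);
  circ_nil : circ_len = 0%N ->
    u = circ_h ord0 * u * (circ_h ord0)^-1;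
  circ_first : forall i : 'I_circ_len, i = 0%N :> nat ->
    u = circ_h ord0 * circ_minus i * (circ_h ord0)^-1;
  circ_next : forall i j : 'I_circ_len, j = i.+1 :> nat ->
    circ_plus i =
      circ_h (lift ord0 i) * circ_minus j * (circ_h (lift ord0 i))^-1;
  circ_last : forall i : 'I_circ_len, i.+1 = circ_len ->
    circ_plus i = circ_h ord_max * u * (circ_h ord_max)^-1
}.

Definition trivial_circuit u s (c : circuit u s) : Prop := circ_len c = 0%N.

Definition reduced_circuit u s (c : circuit u s) : Prop :=
  ~ exists i j : 'I_(circ_len c),
      [/\ j = i.+1 :> nat,
          tnth (circ_edge c) j = opp (tnth (circ_edge c) i)
        & edge_subgroup_plus (tnth (circ_edge c) i) (@circ_h _ _ c (lift ord0 i))].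

Definition without_circuit : Prop :=
  forall (s : vertex GG) (u : fundamental_group),
    vertex_subgroup s u -> u <> 1 ->
    forall c : circuit u s, reduced_circuit c -> trivial_circuit c.

End FundamentalGroup.

Arguments vertex_map {GG} T {s} x.
Arguments vertex_subgroup {GG} T s.

(* Main.v *)
From HB Require Import structures.
Require Import Defs.
From mathcomp Require Import all_boot order ssralg ssrnum ssrint intdiv.
From mathcomp Require Import boolp classical_sets.
From mathcomp Require Import zify.

Set Implicit Arguments.
Unset Strict Implicit.
Unset Printing Implicit Defensive.

Local Open Scope group_scope.

(** Let G be the fundamental group, acting on its Bass-Serre tree.  The absence
    of circuits says exactly what is needed about centralizers: if u is a
    nontrivial element of a vertex subgroup G_s and g commutes with u, then u
    fixes both G_s and g G_s, hence the geodesic between them; the elements by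
    which u acts along the edges of this geodesic form a reduced circuit at u
    whose path is the path of the normal form of g.  This path is therefore
    empty, and g lies in G_s ([centralizer_vertex]).

    Let x be a root of g <> 1; then x commutes with g.  If g is elliptic, that
    is, lies in a conjugate of a vertex subgroup, its whole centralizer lies in
    that conjugate ([elliptic_centralizer]).  Otherwise g translates an axis,
    and a nontrivial element of its centralizer fixes no vertex, since it would
    force g to be elliptic; so the centralizer acts freely and by translations
    on the axis and is infinite cyclic ([hyperbolic_centralizer]).  The
    statements about root structure follow by carrying roots between G and its
    vertex groups, which embed in G ([vertex_map_inj]).  For the roots of 1, a
    nontrivial torsion element cannot be elliptic when the vertex groups are
    torsion free, nor can it have an infinite cyclic centralizer.

    The tree is built from normal forms, as in van der Waerden's proof of the
    normal form theorem.  All vertex groups are embedded in their direct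
    product, so that paths through different vertex groups are words over one
    group.  Vertex groups and edges act on the normal forms that start at a
    given vertex ([act], [edge_act]); moving the base vertex along the tree T
    turns this into an action of G ([fg_act]), and [value] reads a normal form
    as an element of G, equivariantly.  A normal form without its last
    coefficient is a vertex of the Bass-Serre tree, and [dist] is the tree
    distance in terms of common prefixes.

    No axis is constructed.  The only geometry used is that G preserves a
    distance satisfying the four-point inequality ([dist4]): for g with
    d(o, g^n o) = n L and L > 0, the Busemann function
    h |-> lim (d(h o, g^n o) - n L) is a homomorphism from the centralizer of g
    to the integers, and an element of its kernel fixes o ([busemannM],
    [busemann_ker]).  A point o that minimises d(o, g o) has the required
    property, because otherwise a neighbour of o would be moved less, or g
    would invert an edge ([axis_turn]). *)

(** * Normal forms and their tree distance *)

(** A graph of groups all of whose groups are subgroups of one group [P]: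
    [vgrp s] is the vertex group at [s], and [eiso a] is the graph of the
    isomorphism phi_a between the two edge subgroups of [a].  Having a single
    ambient group avoids transporting elements along equalities of vertices. *)
Record edge_system (X : graph) (P : groupType) := EdgeSystem {
  vgrp : vertex X -> set P;
  eiso : edge X -> P -> P -> Prop;
  vgrp1 : forall s, vgrp s 1;
  vgrpM : forall s x y, vgrp s x -> vgrp s y -> vgrp s (x * y);
  vgrpV : forall s x, vgrp s x -> vgrp s x^-1;
  eiso_vgrp : forall a x y, eiso a x y -> vgrp (origin a) x;
  eiso_opp : forall a x y, eiso a x y -> eiso (opp a) y x;
  eiso_fun : forall a x y y', eiso a x y -> eiso a x y' -> y = y';
  eiso1 : forall a, eiso a 1 1;
  eisoV : forall a x y, eiso a x y -> eiso a x^-1 y^-1;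
  eisoM : forall a x y x' y',
    eiso a x y -> eiso a x' y' -> eiso a (x * x') (y * y')
}.

Section NormalForms.
Variables (X : graph) (P : groupType) (S : edge_system X P).
Implicit Types (s : vertex X) (a b : edge X) (g h x y : P).

Local Notation V := (vgrp S).
Local Notation iso := (eiso S).

Definition egrp a : set P := [set x | exists y, iso a x y].

Definition phi a x : P := xget 1 [set y | iso a x y].

Lemma phiP a x : egrp a x -> iso a x (phi a x).
Proof. by move=> [y xy]; apply: (@xgetI _ 1 [set y | iso a x y] y xy). Qed.

Lemma phi_eq a x y : iso a x y -> phi a x = y.
Proof. by move=> xy; apply: (eiso_fun _ xy); apply: phiP; exists y. Qed.

Lemma phiM a x y : egrp a x -> egrp a y -> phi a (x * y) = phi a x * phi a y.
Proof. by move=> /phiP ax /phiP ay; apply/phi_eq/eisoM. Qed.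

Lemma phi1 a : phi a 1 = 1.
Proof. exact/phi_eq/eiso1. Qed.

Lemma phi_egrp a x : egrp a x -> egrp (opp a) (phi a x).
Proof. by move=> /phiP xy; exists x; apply: eiso_opp. Qed.

Lemma egrp_vgrp a x : egrp a x -> V (origin a) x.
Proof. by case=> y; apply: eiso_vgrp. Qed.

Lemma egrp1 a : egrp a 1.
Proof. by exists 1; apply: eiso1. Qed.

Lemma egrpM a x y : egrp a x -> egrp a y -> egrp a (x * y).
Proof. by move=> [x' hx] [y' hy]; exists (x' * y'); apply: eisoM. Qed.


Lemma egrpV a x : egrp a x -> egrp a x^-1.
Proof. by move=> [x' hx]; exists x'^-1; apply: eisoV. Qed.

(** The representative chosen in the left coset of [g] modulo [egrp a].  The
    subgroup itself must be represented by 1: cancellation of an edge against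
    its opposite is then recognised by a coefficient equal to 1. *)
Definition rep a g : P :=
  if `[< egrp a g >] then 1 else xget 1 [set r | egrp a (g^-1 * r)].

Lemma rep_in a g : egrp a (g^-1 * rep a g).
Proof.
rewrite /rep; case: asboolP => [ag|_]; first by rewrite mulg1; apply: egrpV.
apply: (@xgetI _ 1 [set r | egrp a (g^-1 * r)] g).
by rewrite /= mulVg; apply: egrp1.
Qed.

Lemma egrp_mulr a g e : egrp a e -> egrp a (g * e) <-> egrp a g.
Proof.
move=> ae; split=> [age|ag]; last exact: egrpM.
by rewrite -(mulgK e g); apply: egrpM => //; apply: egrpV.
Qed.

Lemma egrp_mull a g e : egrp a e -> egrp a (e * g) <-> egrp a g.
Proof.
move=> ae; split=> [age|ag]; last exact: egrpM.
by rewrite -(mulKg e g); apply: egrpM => //; apply: egrpV.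
Qed.

(** The choice depends on the coset only, because the sets from which the two
    representatives are chosen are equal. *)
Lemma rep_coset a g e : egrp a e -> rep a (g * e) = rep a g.
Proof.
move=> ae; rewrite /rep (asbool_equiv_eq (egrp_mulr g ae)).
case: asboolP => // _; congr (xget 1 _); apply/funext => r; apply/propext.
rewrite /mkset invgM -mulgA; exact/egrp_mull/egrpV.
Qed.

Lemma rep_eq1 a g : rep a g = 1 <-> egrp a g.
Proof.
split=> [r1|ag]; last by rewrite /rep asboolT.
by have := rep_in a g; rewrite r1 mulg1 => /egrpV; rewrite invgK.
Qed.

Lemma rep_egrp1 a e : egrp a e -> rep a e = 1.
Proof. by move/rep_eq1. Qed.

Lemma repK a g : rep a (rep a g) = rep a g.
Proof. by rewrite -{1}(mulVKg g (rep a g)) rep_coset //; apply: rep_in. Qed.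

Lemma rep_mul a g h : rep a (g * rep a h) = rep a (g * h).
Proof.
have -> : g * rep a h = g * h * (h^-1 * rep a h) by rewrite -mulgA mulVKg.
exact/rep_coset/rep_in.
Qed.

Lemma rep_inV a g : egrp a ((rep a g)^-1 * g).
Proof. by have /egrpV := rep_in a g; rewrite invgM invgK. Qed.

Lemma vgrp_rep a g : V (origin a) g -> V (origin a) (rep a g).
Proof.
move=> ag; rewrite -(mulVKg g (rep a g)); apply: vgrpM => //.
exact/egrp_vgrp/rep_in.
Qed.

(** Writing g = r e with r the representative of g and e in the edge group,
    the relation e a = a phi_a(e) moves e across the edge [a]; [carry a g] is
    what arrives on the other side. *)
Definition carry a g : P := phi a ((rep a g)^-1 * g).

Lemma carry_egrp a g : egrp (opp a) (carry a g).
Proof. exact/phi_egrp/rep_inV. Qed.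

Lemma vgrp_carry a g : V (terminus a) (carry a g).
Proof. exact/egrp_vgrp/carry_egrp. Qed.

Lemma carry_mul a g h : carry a (g * rep a h) * carry a h = carry a (g * h).
Proof.
rewrite /carry -phiM; try exact: rep_inV.
by rewrite rep_mul !mulgA mulgK.
Qed.

Lemma carry_rep a h : rep a h = h -> carry a h = 1.
Proof. by rewrite /carry => ->; rewrite mulVg phi1. Qed.

(** [Node h1 a1 (... (Node hn an (Leaf h)))] stands for h1 a1 ... hn an h.  The
    last coefficient [h] is unconstrained in its vertex group; the rest is a
    vertex of the Bass-Serre tree at distance n from the base vertex. *)
Inductive nf : Type := Leaf of P | Node of P & edge X & nf.

Implicit Types (u v w z : nf).

Fixpoint act g w : nf :=
  match w with
  | Leaf h => Leaf (g * h)
  | Node h a w' => Node (rep a (g * h)) a (act (carry a (g * h)) w')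
  end.

Definition starts a w : bool :=
  if w is Node h b _ then (h == 1) && (b == a) else false.

Definition edge_act a w : nf :=
  if w is Node h b w' then
    if (h == 1) && (b == opp a) then w' else Node 1 a w
  else Node 1 a w.

(** Reduced words with coset representatives as coefficients, along a path
    starting at [s]. *)
Fixpoint wf s w : Prop :=
  match w with
  | Leaf h => V s h
  | Node h a w' => [/\ origin a = s, V s h, rep a h = h,
                       ~~ starts (opp a) w' & wf (terminus a) w']
  end.

Lemma act1 s w : wf s w -> act 1 w = w.
Proof.
elim: w s => [h|h a w IHw] s /=; first by rewrite mul1g.
by case=> _ _ ah _ wfw; rewrite mul1g ah (carry_rep ah) (IHw _ wfw).
Qed.

Lemma actM g h w : act g (act h w) = act (g * h) w.
Proof.
elim: w g h => [k|k a w IHw] g h /=; first by rewrite mulgA.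
by rewrite rep_mul IHw carry_mul mulgA.
Qed.

(** This is why reducedness survives [act]: multiplying by an element of the
    edge group of [b] preserves the coset of the first coefficient. *)
Lemma starts_act s b c w : wf s w -> egrp b c ->
  starts b (act c w) = starts b w.
Proof.
case: w => [//|h a w] /= [_ _ ah _ _] bc.
have [ab|_] := eqVneq a b; last by rewrite !andbF.
subst a; rewrite !andbT; apply/eqP/eqP => [/rep_eq1|->].
  by move/(proj1 (egrp_mull _ bc))/rep_eq1; rewrite ah.
by apply/rep_eq1; rewrite mulg1.
Qed.

Lemma wf_act s g w : V s g -> wf s w -> wf s (act g w).
Proof.
elim: w s g => [h|h a w IHw] s g /= sg; first exact: vgrpM.
case=> sa sh ah wa wfw; subst s; split=> //.
- by apply: vgrp_rep; apply: vgrpM.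
- exact: repK.
- by rewrite (starts_act wfw) //; apply: carry_egrp.
- by apply: IHw => //; apply: vgrp_carry.
Qed.

Lemma opp_neqF a : (a == opp a) = false.
Proof. by rewrite eq_sym; apply/negbTE/opp_neq. Qed.

Lemma terminus_opp a : terminus (opp a) = origin a.
Proof. by rewrite /terminus oppK. Qed.

Variant edge_act_spec a w : nf -> Prop :=
  | EdgeActCancel w' of w = Node 1 (opp a) w' : edge_act_spec a w w'
  | EdgeActPush of ~~ starts (opp a) w : edge_act_spec a w (Node 1 a w).

Lemma edge_actP a w : edge_act_spec a w (edge_act a w).
Proof.
case: w => [h|h b w] /=; first by right.
by case: ifP => [/andP[/eqP-> /eqP->]|hb]; [left | right; rewrite /= hb].
Qed.

Lemma edge_act_push a w : ~~ starts (opp a) w -> edge_act a w = Node 1 a w.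
Proof. by case: w => [//|h b w] /=; case: ifP. Qed.

Lemma wf_edge_act a w : wf (terminus a) w -> wf (origin a) (edge_act a w).
Proof.
case: edge_actP => [w' ->|wa wfw] /=.
  by case=> _ _ _ _; rewrite terminus_opp.
split=> //; first exact: vgrp1.
exact/rep_egrp1/egrp1.
Qed.

(** The two cases of [edge_act] are exchanged: a reduced word is cancelled by
    [a] exactly when the result can only be pushed by [opp a]. *)
Lemma edge_actK a w : wf (terminus a) w -> edge_act (opp a) (edge_act a w) = w.
Proof.
case: (edge_actP a w) => [w' ->|wa wfw] /=; last by rewrite !eqxx oppK eqxx.
by case=> _ _ _ wa _; rewrite edge_act_push.
Qed.

Lemma edge_actKV a w : wf (origin a) w -> edge_act a (edge_act (opp a) w) = w.
Proof. by rewrite -terminus_opp => /edge_actK; rewrite oppK. Qed.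

(** The defining relation f_a(h) t_a = t_a f_{-a}(h) of the fundamental group,
    as an identity between operations on normal forms. *)
Lemma act_edge_act a x y w : iso a x y -> wf (terminus a) w ->
  act x (edge_act a w) = edge_act a (act y w).
Proof.
move=> xy wfw; have ey : egrp (opp a) y by exists x; apply: eiso_opp.
have yx := eiso_opp xy; have ex : egrp a x by exists y.
have pyx := phi_eq yx; have pxy := phi_eq xy.
have := starts_act wfw ey; case: (edge_actP a w) => [w' wE|wa] stE.
  move: wfw; rewrite wE /= => -[_ _ _ wa _].
  by rewrite mulg1 /carry (rep_egrp1 ey) invg1 mul1g pyx !eqxx.
rewrite (negbTE wa) in stE; rewrite edge_act_push ?stE //=.
by rewrite mulg1 /carry (rep_egrp1 ex) invg1 mul1g pxy.
Qed.

Fixpoint nsize w : nat := if w is Node _ _ w' then (nsize w').+1 else 0.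

(** The length of the common initial segment of the two paths in the tree; the
    last coefficients are ignored. *)
Fixpoint lcp w z : nat :=
  match w, z with
  | Node h a w', Node k b z' =>
      if (h == k) && (a == b) then (lcp w' z').+1 else 0
  | _, _ => 0
  end.

Lemma lcpC w z : lcp w z = lcp z w.
Proof.
elim: w z => [h|h a w IHw] [k|k b z] //=.
by rewrite IHw (eq_sym k) (eq_sym b).
Qed.

Lemma lcp_size w z : lcp w z <= nsize w.
Proof.
elim: w z => [h|h a w IHw] [k|k b z] //=.
by case: ifP => // _; apply: IHw.
Qed.

Lemma lcp_refl w : lcp w w = nsize w.
Proof. by elim: w => [h|h a w /= ->] //=; rewrite !eqxx. Qed.

Lemma lcp_min u w z : minn (lcp u w) (lcp w z) <= lcp u z.
Proof.
elim: w u z => [h|h a w IHw] [k|k b u] [l|l c z] //=; rewrite ?minn0 ?min0n //.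
case: (boolP ((k == h) && _)) => [/andP[/eqP-> /eqP->]|_];
  last by rewrite min0n.
case: ifP => _; last by rewrite minn0.
by rewrite minnSS ltnS IHw.
Qed.

Definition dist w z : nat := nsize w + nsize z - (lcp w z).*2.

Lemma distE w z : dist w z + (lcp w z).*2 = nsize w + nsize z.
Proof.
by have := lcp_size w z; have := lcp_size z w; rewrite lcpC /dist; lia.
Qed.

Lemma distxx w : dist w w = 0.
Proof. by have := distE w w; rewrite lcp_refl; lia. Qed.

Lemma distC w z : dist w z = dist z w.
Proof. by rewrite /dist addnC lcpC. Qed.

(** The four-point characterisation of trees.  It follows from the ultrametric
    inequality for common prefixes. *)
Lemma dist4 u v w z :
  dist u v + dist w z <= maxn (dist u w + dist v z) (dist u z + dist v w).
Proof.
have := distE u v; have := distE w z; have := distE u w; have := distE v z.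
have := distE u z; have := distE v w.
have := lcp_min u w v; have := lcp_min u z v; have := lcp_min w u z.
have := lcp_min w v z; rewrite (lcpC z v) (lcpC w u) (lcpC w v).
lia.
Qed.

Lemma dist_leaf w h : dist (Leaf h) w = nsize w.
Proof. by have := distE (Leaf h) w; rewrite /=; lia. Qed.

Lemma nsize_act g w : nsize (act g w) = nsize w.
Proof. by elim: w g => //= h a w IHw g; rewrite IHw. Qed.

(** Left multiplication permutes the cosets of the first coefficients, and
    words with the same first letter receive the same carried element. *)
Lemma lcp_act s g w z : wf s w -> wf s z -> lcp (act g w) (act g z) = lcp w z.
Proof.
elim: w s z g => [h|h a w IHw] s [k|k b z] g //= [_ _ ah _ wfw] [_ _ bk _ wfz].
have [ab|_] := eqVneq a b; last by rewrite !andbF.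
subst b; rewrite !andbT; have [hk|hk] := eqVneq h k.
  by subst k; rewrite eqxx (IHw (terminus a)).
case: eqP => // ghk; case/eqP: hk; rewrite -ah -bk.
have -> : k = h * (h^-1 * k) by rewrite mulVKg.
rewrite rep_coset //.
have := egrpM (rep_inV a (g * h)) (egrpV (rep_inV a (g * k))).
rewrite ghk => /egrpV.
move: (egrpM (rep_in a (g * h)) (rep_inV a (g * k))); rewrite ghk.
by rewrite !mulgA mulgK invgM -!mulgA mulKg.
Qed.

Lemma dist_act s g w z : wf s w -> wf s z ->
  dist (act g w) (act g z) = dist w z.
Proof. by move=> wfw wfz; rewrite /dist !nsize_act (lcp_act g wfw wfz). Qed.

Lemma starts_lcp0 a w z :
  ~~ starts a z -> lcp (Node 1 a w) z = 0.
Proof.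
by case: z => [//|h b z] /=; rewrite (eq_sym 1) (eq_sym a) => /negbTE->.
Qed.

(** If [a] cancels against one word and is pushed on the other, the two words
    have no common prefix before or after; the lengths then change by -1
    and +1. *)
Lemma dist_edge_act a w z : wf (terminus a) w -> wf (terminus a) z ->
  dist (edge_act a w) (edge_act a z) = dist w z.
Proof.
case: (edge_actP a w) => [w' ->|wa]; case: (edge_actP a z) => [z' ->|za] /=.
- by move=> _ _; rewrite /dist /= !eqxx /=; lia.
- case=> _ _ _ wa _ _; rewrite /dist starts_lcp0 // lcpC starts_lcp0 //=;
    last first.
    by rewrite oppK in wa.
  by lia.
- move=> _ [_ _ _ za _]; rewrite /dist starts_lcp0 /=;
    last by rewrite oppK in za.
  by rewrite [lcp w _]lcpC starts_lcp0 //; lia.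
- by move=> _ _; rewrite /dist /= !eqxx /=; lia.
Qed.

(** The operation of the element represented by [u], from the normal forms
    starting at the end of [u] to those starting at its origin. *)
Fixpoint nf_act u z : nf :=
  match u with
  | Leaf h => act h z
  | Node h a w => act h (edge_act a (nf_act w z))
  end.

Fixpoint endv s w : vertex X :=
  if w is Node _ a w' then endv (terminus a) w' else s.

Fixpoint end_mul w x : nf :=
  match w with
  | Leaf h => Leaf (h * x)
  | Node h a w' => Node h a (end_mul w' x)
  end.

Lemma wf_nf_act s u z : wf s u -> wf (endv s u) z -> wf s (nf_act u z).
Proof.
elim: u s => [h|h a u IHu] s /=; first exact: wf_act.
case=> sa sh _ _ wfu wfz; apply: wf_act => //; subst s; apply: wf_edge_act.
exact: IHu.
Qed.

(** A reduced word acts on the trivial word without any cancellation: this is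
    where reducedness is turned into the uniqueness of normal forms. *)
Lemma nf_act_leaf s u x : wf s u -> nf_act u (Leaf x) = end_mul u x.
Proof.
elim: u s => [//|h a u IHu] s /= [_ _ ah ua wfu].
have e : nf_act u (Leaf x) = end_mul u x by exact: IHu wfu.
rewrite e edge_act_push /=; last by case: (u) ua.
rewrite mulg1 ah (carry_rep ah).
suff -> : act 1 (end_mul u x) = end_mul u x by [].
elim: u (terminus a) wfu {IHu e ua} => [k|k b u IHu] t /=;
  first by rewrite mul1g.
by case=> _ _ bk _ wfu; rewrite mul1g bk (carry_rep bk) (IHu _ wfu).
Qed.

Lemma end_mul1 u : end_mul u 1 = u.
Proof. by elim: u => [h|h a u IHu] /=; rewrite ?mulg1 ?IHu. Qed.

Lemma nf_act_leaf1 s u : wf s u -> nf_act u (Leaf 1) = u.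
Proof. by move/nf_act_leaf->; rewrite end_mul1. Qed.

Lemma endv_act s g u : endv s (act g u) = endv s u.
Proof. by elim: u s g => [//|h a u IHu] s g /=. Qed.

Lemma endv_edge_act a u : endv (origin a) (edge_act a u) = endv (terminus a) u.
Proof. by case: edge_actP => [u' ->|//] /=; rewrite terminus_opp. Qed.

End NormalForms.

(** * The vertex groups inside their direct product *)

Section Multiplicative.
Variables (G H : groupType) (f : {multiplicative G -> H}).

Lemma mult_morph1 : f 1 = 1.
Proof. by apply: (mulgI (f 1)); rewrite -gmulfM !mulg1. Qed.

Lemma mult_morphV x : f x^-1 = (f x)^-1.
Proof. by apply: (mulgI (f x)); rewrite -gmulfM !mulgV mult_morph1. Qed.
End Multiplicative.

Section ProductGroup.
Variables (I : Type) (F : I -> groupType).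

Definition dprod : Type := forall i, F i.

HB.instance Definition _ := gen_eqMixin dprod.
HB.instance Definition _ := gen_choiceMixin dprod.

Let mul (f g : dprod) : dprod := fun i => f i * g i.
Let one : dprod := fun i => 1.
Let inv (f : dprod) : dprod := fun i => (f i)^-1.

Fact dprod_mulA : associative mul.
Proof.
by move=> f g h; apply: functional_extensionality_dep => i; apply: mulgA.
Qed.
Fact dprod_mul1 : left_id one mul.
Proof.
by move=> f; apply: functional_extensionality_dep => i; apply: mul1g.
Qed.
Fact dprod_mulr1 : right_id one mul.
Proof.
by move=> f; apply: functional_extensionality_dep => i; apply: mulg1.
Qed.
Fact dprod_mulVx : left_inverse one inv mul.
Proof.
by move=> f; apply: functional_extensionality_dep => i; apply: mulVg.
Qed.
Fact dprod_mulxV : right_inverse one inv mul.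
Proof.
by move=> f; apply: functional_extensionality_dep => i; apply: mulgV.
Qed.

HB.instance Definition _ := isGroup.Build dprod
  dprod_mulA dprod_mul1 dprod_mulr1 dprod_mulVx dprod_mulxV.

Lemma dprodM (f g : dprod) i : (f * g) i = f i * g i. Proof. by []. Qed.
End ProductGroup.

Section VertexSystem.
Variable GG : graph_of_groups.

Definition ambient := dprod (@vgroup GG).
HB.instance Definition _ := Group.on ambient.

(** The element of the direct product supported at [s]. *)
Definition embed (s : vertex GG) (x : vgroup s) : ambient :=
  dfwith (fun t => 1 : vgroup t) x.

Lemma embed_in s (x : vgroup s) : embed x s = x. Proof. exact: dfwith_in. Qed.
Lemma embed_out s (x : vgroup s) t : t != s -> embed x t = 1.
Proof. by rewrite eq_sym => st; apply: dfwith_out. Qed.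

Lemma ambient_ext (f g : ambient) : (forall i, f i = g i) -> f = g.
Proof. exact: functional_extensionality_dep. Qed.

Lemma embedM s (x y : vgroup s) : embed (x * y) = embed x * embed y.
Proof.
apply: ambient_ext => t; rewrite dprodM.
have [->|ts] := eqVneq t s; first by rewrite !embed_in.
by rewrite !embed_out // mulg1.
Qed.

Lemma embed1 s : embed (1 : vgroup s) = 1.
Proof. by apply: (mulgI (embed (1 : vgroup s))); rewrite -embedM !mulg1. Qed.

Lemma embedV s (x : vgroup s) : embed x^-1 = (embed x)^-1.
Proof. by apply: (mulgI (embed x)); rewrite -embedM !mulgV embed1. Qed.

Definition supp (s : vertex GG) : set ambient := range (@embed s).

Lemma suppE s f : supp s f -> embed (f s) = f.
Proof. by case=> x _ <-; rewrite embed_in. Qed.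

Lemma supp_embed s (x : vgroup s) : supp s (embed x). Proof. by exists x. Qed.

(** The counterpart of [edge_iso] inside the direct product, available before
    the vertex groups are known to embed in the fundamental group. *)
Inductive edge_rel : edge GG -> ambient -> ambient -> Prop :=
| edge_rel_pos a (k : egroup a) :
    edge_rel (val a) (embed (mono_o a k)) (embed (mono_e a k))
| edge_rel_neg a (k : egroup a) :
    edge_rel (opp (val a)) (embed (mono_e a k)) (embed (mono_o a k)).

Definition posE := {a : edge GG | a \in @positive GG}.

Lemma edge_rel_inv b x y : edge_rel b x y ->
  (exists (a : posE) (k : egroup a),
     [/\ b = val a, x = embed (mono_o a k) & y = embed (mono_e a k)]) \/
  (exists (a : posE) (k : egroup a),
     [/\ b = opp (val a), x = embed (mono_e a k) & y = embed (mono_o a k)]).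
Proof. by case=> a k; [left | right]; exists a, k. Qed.

Lemma val_neq_opp (a a' : posE) : val a <> opp (val a').
Proof.
move=> aa'; have := positive_orientation (val a').
by rewrite (valP a') -aa' (valP a).
Qed.

Lemma edge_relP (a : posE) x y :
  edge_rel (val a) x y <->
  exists k : egroup a, x = embed (mono_o a k) /\ y = embed (mono_e a k).
Proof.
split=> [/edge_rel_inv[] [a' [k [aa' -> ->]]]|[k [-> ->]]].
- by move/val_inj: aa' => aa'; subst a'; exists k.
- by case: (val_neq_opp aa').
- exact: edge_rel_pos.
Qed.

Lemma edge_relN (a : posE) x y :
  edge_rel (opp (val a)) x y <->
  exists k : egroup a, x = embed (mono_e a k) /\ y = embed (mono_o a k).
Proof.
split=> [/edge_rel_inv[] [a' [k [aa' -> ->]]]|[k [-> ->]]].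
- by case: (@val_neq_opp a' a).
- by move/(can_inj (@oppK _))/val_inj: aa' => aa'; subst a'; exists k.
- exact: edge_rel_neg.
Qed.

Lemma edge_signP (b : edge GG) :
  exists a : posE, b = val a \/ b = opp (val a).
Proof.
have := positive_orientation b;
  case: (boolP (b \in positive GG)) => [bp _|_ bn].
  by exists (exist _ b bp); left.
have bp : opp b \in positive GG by apply/negbFE; rewrite -bn.
by exists (exist _ (opp b) bp); right; rewrite /= oppK.
Qed.
Lemma embed_inj s : injective (@embed s).
Proof. by move=> x y xy; rewrite -(embed_in x) -(embed_in y) xy. Qed.

Fact edge_rel_opp a x y : edge_rel a x y -> edge_rel (opp a) y x.
Proof. by case=> b k; rewrite ?oppK; constructor. Qed.

Fact edge_rel_supp a x y : edge_rel a x y -> supp (origin a) x.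
Proof. by case=> b k; apply: supp_embed. Qed.

Fact edge_rel_fun a x y y' : edge_rel a x y -> edge_rel a x y' -> y = y'.
Proof.
case: (edge_signP a) => b [->|->].
  move=> /edge_relP[k [-> ->]] /edge_relP[k' [/embed_inj/mono_o_inj-> ->]] //.
move=> /edge_relN[k [-> ->]] /edge_relN[k' [/embed_inj/mono_e_inj-> ->]] //.
Qed.

Fact edge_rel1 a : edge_rel a 1 1.
Proof.
case: (edge_signP a) => b [->|->].
  by apply/edge_relP; exists 1; rewrite !mult_morph1 !embed1.
by apply/edge_relN; exists 1; rewrite !mult_morph1 !embed1.
Qed.

Fact edge_relM a x y x' y' : edge_rel a x y -> edge_rel a x' y' ->
  edge_rel a (x * x') (y * y').
Proof.
case: (edge_signP a) => b [->|->].
  move=> /edge_relP[k [-> ->]] /edge_relP[k' [-> ->]].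
  by apply/edge_relP; exists (k * k'); rewrite !gmulfM !embedM.
move=> /edge_relN[k [-> ->]] /edge_relN[k' [-> ->]].
by apply/edge_relN; exists (k * k'); rewrite !gmulfM !embedM.
Qed.

Fact edge_relV a x y : edge_rel a x y -> edge_rel a x^-1 y^-1.
Proof.
case: (edge_signP a) => b [->|->].
  move=> /edge_relP[k [-> ->]].
  by apply/edge_relP; exists k^-1; rewrite !mult_morphV !embedV.
move=> /edge_relN[k [-> ->]].
by apply/edge_relN; exists k^-1; rewrite !mult_morphV !embedV.
Qed.

Fact supp1 s : supp s 1. Proof. by exists 1 => //; apply: embed1. Qed.
Fact suppM s x y : supp s x -> supp s y -> supp s (x * y).
Proof. by move=> [x' _ <-] [y' _ <-]; rewrite -embedM; apply: supp_embed. Qed.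
Fact suppV s x : supp s x -> supp s x^-1.
Proof. by move=> [x' _ <-]; rewrite -embedV; apply: supp_embed. Qed.

Definition vertex_system : edge_system GG ambient :=
  EdgeSystem supp1 suppM suppV edge_rel_supp edge_rel_opp edge_rel_fun
    edge_rel1 edge_relV edge_relM.
End VertexSystem.

(** * Maximal trees of a connected graph span it *)

Section Walks.
Variable X : graph.
Implicit Types (s t r : vertex X) (a b : edge X) (p q : seq (edge X)).

Lemma walk_cat s p t q r : walk s p t -> walk t q r -> walk s (p ++ q) r.
Proof.
elim: p s => [|a p IHp] s /=; first by move=> /eqP->.
by case/andP=> -> pt qr /=; apply: IHp.
Qed.

Lemma walk_catP s p q r : walk s (p ++ q) r ->
  exists2 t, walk s p t & walk t q r.
Proof.
elim: p s => [|a p IHp] s /=; first by exists s.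
by case/andP=> -> /IHp[t pt qr]; exists t.
Qed.

Definition rev_walk p : seq (edge X) := rev (map (@opp X) p).

Lemma rev_walkP s p t : walk s p t -> walk t (rev_walk p) s.
Proof.
elim: p s => [|a p IHp] s /=; first by rewrite eq_sym.
case/andP=> /eqP sa pt; rewrite /rev_walk /= rev_cons -cats1.
by apply: (walk_cat (IHp _ pt)); rewrite /= terminus_opp sa /terminus !eqxx.
Qed.

Lemma not_reducedP p : ~~ reduced_walk p ->
  exists p1 a p2, p = p1 ++ a :: opp a :: p2.
Proof.
elim: p => [//|a [//|b p] IHp]; rewrite /reduced_walk /= negb_and negbK.
case/orP=> [/eqP->|nr]; first by exists [::], a, p.
have [p1 [c [p2 ->]]] := IHp nr.
by exists (a :: p1), c, p2.
Qed.

Lemma reduced_cons a p : reduced_walk (a :: p) -> reduced_walk p.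
Proof. exact: path_sorted. Qed.

Lemma reduced_cat p q : reduced_walk (p ++ q) -> reduced_walk p.
Proof.
by rewrite /reduced_walk; case: p => [//|a p] /=; rewrite cat_path => /andP[].
Qed.

End Walks.

Section Spanning.
Variables (X : graph) (T : subgraph X).
Hypothesis tree : is_tree T.
Variable a0 : edge X.
Hypothesis a0_in : origin a0 \in sub_vertex T.
Hypothesis a0_out : terminus a0 \notin sub_vertex T.

Let E' := sub_edge T :|: [set a0; opp a0].
Let V' := terminus a0 |: sub_vertex T.

Fact grow_opp a : a \in E' -> opp a \in E'.
Proof.
rewrite !inE => /orP[/sub_opp->//|/orP[]/eqP->]; first by rewrite eqxx !orbT.
by rewrite oppK eqxx !orbT.
Qed.

Fact grow_origin a : a \in E' -> origin a \in V'.
Proof.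
rewrite !inE => /orP[/sub_origin->|/orP[]/eqP->]; first by rewrite orbT.
  by rewrite a0_in orbT.
by rewrite eqxx.
Qed.

Definition grow : subgraph X := Subgraph grow_opp grow_origin.

Lemma origin_grow a : a \in E' -> origin a = terminus a0 -> a = opp a0.
Proof.
rewrite !inE => /orP[/sub_origin aT|/orP[]/eqP->//] e.
  by rewrite e (negbTE a0_out) in aT.
by move: a0_out; rewrite -e a0_in.
Qed.

Lemma terminus_tree a : a \in sub_edge T -> terminus a \in sub_vertex T.
Proof. by move/sub_opp/sub_origin. Qed.

(** The new vertex has [opp a0] as its only outgoing edge, so a reduced walk
    that leaves the old tree through [a0] must stop there. *)
Lemma grow_walk s q t : s \in sub_vertex T -> walk s q t ->
  all [in E'] q -> reduced_walk q ->
  (t \in sub_vertex T /\ all [in sub_edge T] q) \/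
  (t = terminus a0 /\
   exists2 q', q = rcons q' a0 &
     walk s q' (origin a0) /\ all [in sub_edge T] q').
Proof.
elim: q s => [|b q IHq] s sT /=; first by move=> /eqP<-; left.
case/andP=> /eqP bs qt /andP[bE qE] rq.
have rq' := reduced_cons rq.
have /orP[bT|/set2P[ba|ba]] : (b \in sub_edge T) || (b \in [set a0; opp a0]).
- by move: bE; rewrite !inE.
- have [[tT qT]|[tE [q' qE' [wq' q'T]]]] := IHq _ (terminus_tree bT) qt qE rq'.
    by left; rewrite bT.
  by right; split=> //; exists (b :: q'); rewrite ?qE' //= bs eqxx bT.
- subst b; case: q qt qE rq {rq' IHq} =>
    [/= /eqP<- _ _|c q /= /andP[/eqP oc _] /andP[cE _]].
    by right; split=> //; exists [::] => //=; rewrite bs eqxx.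
  by rewrite (origin_grow cE oc) /reduced_walk /= eqxx.
- by move: a0_out; rewrite /terminus -ba bs sT.
Qed.

(** Adding an edge with exactly one endpoint in a tree gives a tree; this
    contradicts maximality as soon as some vertex is missed. *)
Lemma grow_tree : is_tree grow.
Proof.
case: (tree) => [[s0 s0T] conn acyc]; split.
- by exists s0; rewrite inE s0T orbT.
- have sub p : all [in sub_edge T] p -> all [in E'] p.
    by apply: sub_all => a; rewrite !inE => ->.
  have aE : a0 \in E' by rewrite !inE eqxx orbT.
  have aE' := grow_opp aE.
  move=> s t /setU1P[->|sT] /setU1P[->|tT].
  + by exists [::]; rewrite /= ?eqxx.
  + have [p pt pT] := conn _ _ a0_in tT; exists (opp a0 :: p) => /=.
      by rewrite /terminus eqxx oppK.
    by rewrite aE' sub.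
  + have [p pt pT] := conn _ _ sT a0_in; exists (p ++ [:: a0]).
      by apply: (walk_cat pt); rewrite /= !eqxx.
    by rewrite all_cat sub //= aE.
  + by have [p pt pT] := conn _ _ sT tT; exists p => //; apply: sub.
- have main s p : s \in sub_vertex T -> walk s p s -> all [in E'] p ->
      reduced_walk p -> p = [::].
    move=> sT ps pE rp; have [[_ pT]|[sE _]] := grow_walk sT ps pE rp.
      exact: acyc sT ps pT rp.
    by rewrite sE (negbTE a0_out) in sT.
  move=> s p /setU1P[->|sT]; last exact: main.
  case: p => [//|b p] /= /andP[/eqP ob pw] /andP[bE pE] rp.
  have bE' := origin_grow bE ob; subst b.
  move: pw; rewrite terminus_opp => pw.
  have [[tT _]|[_ [q pq [qw qT]]]] := grow_walk a0_in pw pE (reduced_cons rp).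
    by rewrite (negbTE a0_out) in tT.
  have q0 : q = [::].
    apply: (acyc _ _ a0_in qw qT); have := reduced_cons rp.
    by rewrite pq -cats1; apply: reduced_cat.
  by move: rp; rewrite pq q0 /reduced_walk /= oppK eqxx.
Qed.
End Spanning.

Lemma exit_edge (X : graph) (A : {set vertex X}) s p t : s \in A ->
  walk s p t -> t \notin A ->
  exists2 a, origin a \in A & terminus a \notin A.
Proof.
elim: p s => [|a p IHp] s sA /=; first by move/eqP<-; rewrite sA.
case/andP=> /eqP oa pt tA; have [aA|aA] := boolP (terminus a \in A).
  exact: IHp aA pt tA.
by exists a; rewrite ?oa.
Qed.

Lemma maximal_tree_spans (X : graph) (T : subgraph X) :
  connected X -> maximal_tree T -> forall s, s \in sub_vertex T.
Proof.
move=> conn [tree maxT] s; have [[s0 s0T] _ _] := tree.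
have [p pw] := conn s0 s; apply/negPn/negP => sT.
have [a aT aT'] := exit_edge s0T pw sT.
have [] := maxT _ (grow_tree tree aT aT') (finset.subsetUr _ _)
  (finset.subsetUl _ _).
by move=> /setP/(_ (terminus a)); rewrite !inE eqxx (negbTE aT').
Qed.

(** * The fundamental group acts on normal forms *)

Section EdgePaths.
Variables (X : graph) (P : groupType) (S : edge_system X P).
Implicit Types (p q : seq (edge X)) (w z : nf X P).

Definition path_act p w : nf X P := foldr (@edge_act X P) w p.

Lemma path_act_cat p q w : path_act (p ++ q) w = path_act p (path_act q w).
Proof. exact: foldr_cat. Qed.

Lemma wf_path_act s p t w : walk s p t -> wf S t w -> wf S s (path_act p w).
Proof.
elim: p s => [|a p IHp] s /=; first by move/eqP->.
by case/andP=> /eqP<- pt wfw; apply: wf_edge_act; apply: IHp.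
Qed.

Lemma path_actK s p t w : walk s p t -> wf S t w ->
  path_act (rev_walk p) (path_act p w) = w.
Proof.
elim: p s => [//|a p IHp] s /=.
case/andP=> /eqP _ pt wfw; rewrite /rev_walk /= rev_cons -cats1 path_act_cat /=.
by rewrite (edge_actK (wf_path_act pt wfw)) (IHp _ pt).
Qed.

Lemma dist_path_act s p t w z : walk s p t -> wf S t w -> wf S t z ->
  dist (path_act p w) (path_act p z) = dist w z.
Proof.
elim: p s => [//|a p IHp] s /= /andP[_ pt] wfw wfz.
by rewrite (dist_edge_act (wf_path_act pt wfw) (wf_path_act pt wfz)) (IHp _ pt).
Qed.

Lemma endv_path_act s p t w : walk s p t -> endv s (path_act p w) = endv t w.
Proof.
elim: p s => [|a p IHp] s /=; first by move=> /eqP->.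
by case/andP=> /eqP<- pt; rewrite endv_edge_act (IHp _ pt).
Qed.

(** A closed walk in a tree is reduced to the empty walk by successive
    cancellations of [a] against [opp a], and each of them acts trivially. *)
Lemma path_act_loop (T : subgraph X) s p w : is_tree T -> s \in sub_vertex T ->
  walk s p s -> all [in sub_edge T] p -> wf S s w -> path_act p w = w.
Proof.
move=> [_ _ acyc] sT; have [n] := ubnP (size p).
elim: n p => // n IHn p pn ps pT wfw.
have [rp|/not_reducedP[p1 [a [p2 pE]]]] := boolP (reduced_walk p).
  by rewrite (acyc s p sT ps pT rp).
have [t p1t] : exists2 t, walk s p1 t & walk t (a :: opp a :: p2) s.
  by apply: walk_catP; rewrite -pE.
rewrite /= => /and3P[/eqP at_ _]; rewrite terminus_opp at_ => p2s.
have -> : path_act p w = path_act (p1 ++ p2) w.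
  rewrite pE !path_act_cat /= (edge_actKV (S:=S)) // at_.
  exact: wf_path_act p2s wfw.
apply: IHn => //; first by move: pn; rewrite pE !size_cat /=; lia.
  exact: walk_cat p1t p2s.
by move: pT; rewrite pE !all_cat /= => /and4P[-> _ _ ->].
Qed.
End EdgePaths.

Section Action.
Variables (GG : graph_of_groups) (T : subgraph GG).
Hypothesis hT : maximal_tree T.

Local Notation S := (vertex_system GG).
Local Notation G := (fundamental_group T).
Local Notation nfG := (nf GG (ambient GG)).
Local Notation wfG := (wf S).

Implicit Types (s t : vertex GG) (a b : edge GG) (w z : nfG) (g h x y : G).

Let tree : is_tree T := proj1 hT.
Let span s : s \in sub_vertex T := maximal_tree_spans (@base_connected GG) hT s.

Lemma tree_path_ex s t :
  exists p, walk s p t && all [in sub_edge T] p.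
Proof.
have [_ conn _] := tree; have [p pt pT] := conn s t (span s) (span t).
by exists p; rewrite pt pT.
Qed.

Definition tree_path s t : seq (edge GG) := xchoose (tree_path_ex s t).

Lemma tree_pathP s t : walk s (tree_path s t) t.
Proof. by have /andP[] := xchooseP (tree_path_ex s t). Qed.

Lemma tree_path_in s t : all [in sub_edge T] (tree_path s t).
Proof. by have /andP[] := xchooseP (tree_path_ex s t). Qed.

(** Change of base vertex: the element of the fundamental groupoid given by the
    path in the maximal tree from [s] to [t]. *)
Definition theta s t w : nfG := path_act (tree_path s t) w.

Lemma wf_theta s t w : wfG t w -> wfG s (theta s t w).
Proof. exact/wf_path_act/tree_pathP. Qed.

Lemma theta_comp s t r w : wfG r w -> theta s t (theta t r w) = theta s r w.
Proof.
move=> wfw; have wfr : wfG s (theta s r w) := wf_theta s wfw.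
have rs := rev_walkP (tree_pathP s r).
have oppT : all [in sub_edge T] (rev_walk (tree_path s r)).
  rewrite all_rev all_map; apply: sub_all (tree_path_in s r) => a.
  exact: sub_opp.
have := @path_act_loop _ _ S T s
  (tree_path s t ++ tree_path t r ++ rev_walk (tree_path s r)) (theta s r w).
rewrite !path_act_cat /theta (path_actK (S := S) (tree_pathP s r)) //;
  apply=> //.
  by apply: (walk_cat (tree_pathP s t)); apply: (walk_cat (tree_pathP t r)).
by rewrite !all_cat !tree_path_in.
Qed.

Lemma theta_id s w : wfG s w -> theta s s w = w.
Proof.
move=> wfw; exact: (path_act_loop tree (span s) (tree_pathP s s) (tree_path_in
  s s) wfw).
Qed.

Lemma thetaK s t w : wfG t w -> theta t s (theta s t w) = w.
Proof. by move=> wfw; rewrite theta_comp // theta_id. Qed.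

(** The letters t_a with [a] in the tree become trivial after this change of
    base vertex, as the presentation requires. *)
Lemma theta_edge a w : a \in sub_edge T -> wfG (terminus a) w ->
  theta (origin a) (terminus a) w = edge_act a w.
Proof.
move=> aT wfw; have wfa := wf_edge_act wfw.
rewrite -[RHS](theta_id wfa); have rs := tree_pathP (terminus a) (origin a).
rewrite -(theta_comp _ (terminus a) wfa); congr theta.
have := @path_act_loop _ _ S T (terminus a)
  (tree_path (terminus a) (origin a) ++ [:: a]) w tree (span _).
rewrite path_act_cat /= /theta => -> //.
  by apply: (walk_cat rs); rewrite /= !eqxx.
by rewrite all_cat tree_path_in /= aT.
Qed.

Section Based.
Variable s0 : vertex GG.

(** Every letter is turned into a loop at [s0] by going to its origin, and
    coming back from its end, inside the maximal tree. *)
Definition letter_act (l : letter GG) w : nfG :=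
  match l with
  | inl u => theta s0 (tag u) (act S (embed (tagged u)) (theta (tag u) s0 w))
  | inr (a, b) =>
      let c := if b then a else opp a in
      theta s0 (origin c) (edge_act c (theta (terminus c) s0 w))
  end.

Definition word_act (u : seq (letter GG)) w : nfG := foldr letter_act w u.

Lemma wf_letter_act l w : wfG s0 w -> wfG s0 (letter_act l w).
Proof.
move=> wfw; case: l => [[s x]|[a b]] /=; apply: wf_theta.
  by apply: wf_act; [apply: supp_embed | apply: wf_theta].
by apply: wf_edge_act; apply: wf_theta.
Qed.

Lemma wf_word_act u w : wfG s0 w -> wfG s0 (word_act u w).
Proof. by move=> wfw; elim: u => [//|l u IHu] /=; apply: wf_letter_act. Qed.

Lemma relation_act u v w : relation T u v -> wfG s0 w ->
  word_act u w = word_act v w.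
Proof.
move=> r wfw; have wt t : wfG t (theta t s0 w) := wf_theta t wfw.
case: r => {u v} [s x y|s|a|a|a k|a|a aT] /=.
- rewrite thetaK; first by rewrite actM embedM.
  by apply: wf_act => //; apply: supp_embed.
- by rewrite embed1 (act1 (wt s)) thetaK.
- have wa := wt (origin a); rewrite terminus_opp thetaK.
    by rewrite (edge_actKV (S:=S)) // thetaK.
  by apply: wf_edge_act; rewrite terminus_opp.
- have wa := wt (terminus a);
    rewrite terminus_opp thetaK ?(edge_actK (S:=S)) ?thetaK //.
  exact: wf_edge_act.
- rewrite terminus_opp.
  have wa := wt (origin (val a)).
  have wo : wfG (terminus (val a)) (edge_act (opp (val a)) (theta (origin (val
    a)) s0 w)).
    by apply: wf_edge_act; rewrite terminus_opp.
  rewrite (thetaK _ wo) thetaK; last first.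
    by apply: wf_act => //; apply: supp_embed.
  have := act_edge_act (S := S) (edge_rel_pos k) wo.
  by rewrite (edge_actKV (S:=S)) // => ->.
- by [].
- by rewrite -theta_edge // theta_comp // thetaK.
Qed.

Lemma word_eq_act u v w : word_eq T u v -> wfG s0 w ->
  word_act u w = word_act v w.
Proof.
move=> uv; elim: uv w => {u v}
  [u v w w' r|u|u v _ IH|u v r _ IH1 _ IH2] z wfz //.
- rewrite /word_act !foldr_cat -!/(word_act _ _) (relation_act r) //.
  exact: wf_word_act.
- by rewrite IH.
- by rewrite IH1 // IH2.
Qed.

Definition fg_act g w : nfG := word_act (repr g) w.

Lemma fg_act_class u w : wfG s0 w -> fg_act (word_class T u) w = word_act u w.
Proof. exact/word_eq_act/repr_word_class. Qed.

Lemma wf_fg_act g w : wfG s0 w -> wfG s0 (fg_act g w).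
Proof. exact: wf_word_act. Qed.

Lemma fg_actM g h w : wfG s0 w -> fg_act (g * h) w = fg_act g (fg_act h w).
Proof.
move=> wfw; rewrite -{1}(word_class_repr g) -{1}(word_class_repr h).
have -> : word_class T (repr g) * word_class T (repr h) =
  word_class T (repr g ++ repr h) by exact: fg_mulE.
by rewrite fg_act_class // /word_act foldr_cat.
Qed.

Lemma fg_act1 w : wfG s0 w -> fg_act 1 w = w.
Proof. exact: (fg_act_class [::]). Qed.

Lemma dist_theta s t w z : wfG t w -> wfG t z ->
  dist (theta s t w) (theta s t z) = dist w z.
Proof. exact/dist_path_act/tree_pathP. Qed.

Lemma dist_letter_act l w z : wfG s0 w -> wfG s0 z ->
  dist (letter_act l w) (letter_act l z) = dist w z.
Proof.
move=> wfw wfz; have ww t := wf_theta t wfw; have wz t := wf_theta t wfz.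
case: l => [[s x]|[a b]] /=.
  have sx := supp_embed x; rewrite dist_theta; try exact: wf_act.
  by rewrite (dist_act _ (ww s) (wz s)) dist_theta.
set c := if b then a else opp a; rewrite dist_theta; try exact: wf_edge_act.
by rewrite (dist_edge_act (ww _) (wz _)) dist_theta.
Qed.

Lemma dist_fg_act g w z : wfG s0 w -> wfG s0 z ->
  dist (fg_act g w) (fg_act g z) = dist w z.
Proof.
move=> wfw wfz; rewrite /fg_act; elim: (repr g) => [//|l u IHu] /=.
by rewrite dist_letter_act //; apply: wf_word_act.
Qed.

Lemma endv_theta s t w : endv s (theta s t w) = endv t w.
Proof. exact/endv_path_act/tree_pathP. Qed.

Lemma endv_fg_act g w : endv s0 (fg_act g w) = endv s0 w.
Proof.
rewrite /fg_act; elim: (repr g) => [//|[[s x]|[a b]] u IHu] /=.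
  by rewrite endv_theta endv_act endv_theta.
by rewrite endv_theta endv_edge_act endv_theta.
Qed.

Lemma fg_act_vertex s (x : vgroup s) w : wfG s w ->
  fg_act (vertex_map T x) (theta s0 s w) = theta s0 s (act S (embed x) w).
Proof.
move=> wfw; rewrite fg_act_class; last exact: wf_theta.
by rewrite /= thetaK.
Qed.

Definition stable_letter a : G := word_class T [:: lt a].

Lemma fg_act_stable a w : wfG (terminus a) w ->
  fg_act (stable_letter a) (theta s0 (terminus a) w) =
    theta s0 (origin a) (edge_act a w).
Proof.
move=> wfw; rewrite fg_act_class; last exact: wf_theta.
by rewrite /= thetaK.
Qed.
End Based.

End Action.

(** * Normal forms as elements of the fundamental group *)

Section Values.
Variables (GG : graph_of_groups) (T : subgraph GG).
Hypothesis hT : maximal_tree T.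

Local Notation S := (vertex_system GG).
Local Notation G := (fundamental_group T).
Local Notation nfG := (nf GG (ambient GG)).
Local Notation wfG := (wf S).
Local Notation theta := (theta hT).
Local Notation fg_act := (fg_act hT).
Local Notation stable := (stable_letter T).

Implicit Types (s t : vertex GG) (a b : edge GG) (w z : nfG) (g : G)
  (h x y : ambient GG).

Lemma word_class_cat u v :
  word_class T (u ++ v) = word_class T u * word_class T v.
Proof. by symmetry; exact: fg_mulE. Qed.

Lemma word_class1 : word_class T [::] = 1.
Proof. by []. Qed.

Lemma word_class_rel u v : relation T u v -> word_class T u = word_class T v.
Proof.
by move=> /(@word_eq_rel _ _ [::] [::]); rewrite /= !cats0 => /word_classP.
Qed.

Lemma vertex_mapM s (x y : vgroup s) :
  vertex_map T (x * y) = vertex_map T x * vertex_map T y.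
Proof. by rewrite -word_class_cat; apply/esym/word_class_rel/rel_mul. Qed.

Lemma vertex_map1 s : vertex_map T (1 : vgroup s) = 1.
Proof. exact/word_class_rel/rel_one. Qed.

Lemma vertex_mapV s (x : vgroup s) : vertex_map T x^-1 = (vertex_map T x)^-1.
Proof.
by apply: (mulgI (vertex_map T x)); rewrite -vertex_mapM !mulgV vertex_map1.
Qed.

Definition vmap s (f : ambient GG) : G := vertex_map T (f s).

Lemma vmapM s f f' : vmap s (f * f') = vmap s f * vmap s f'.
Proof. exact: vertex_mapM. Qed.

Lemma vmap1 s : vmap s 1 = 1.
Proof. exact: vertex_map1. Qed.

Lemma vmapV s f : vmap s f^-1 = (vmap s f)^-1.
Proof. exact: vertex_mapV. Qed.

Lemma vmap_in s (x : vgroup s) : vmap s (embed x) = vertex_map T x.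
Proof. by rewrite /vmap embed_in. Qed.

Lemma vmap_sub s f : vertex_subgroup T s (vmap s f).
Proof. by exists (f s). Qed.

Lemma stableV a : word_class T [:: ltV a] = (stable a)^-1.
Proof.
apply: (mulgI (stable a)); rewrite mulgV -word_class_cat.
exact/word_class_rel/rel_tV.
Qed.

Lemma stable_opp a : stable (opp a) = (stable a)^-1.
Proof. by rewrite -stableV; apply/word_class_rel/rel_opp. Qed.

Lemma stable_tree a : a \in sub_edge T -> stable a = 1.
Proof. by move=> aT; apply/word_class_rel/rel_tree. Qed.

Lemma stable_pos (a : posE GG) (k : egroup a) :
  vertex_map T (mono_o a k) =
    stable (val a) * vertex_map T (mono_e a k) * (stable (val a))^-1.
Proof.
rewrite -stableV /stable_letter /vertex_map -!word_class_cat.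
exact/word_class_rel/rel_edge.
Qed.

Lemma vmap_stable a x y : edge_rel a x y ->
  vmap (origin a) x * stable a = stable a * vmap (terminus a) y.
Proof.
case=> {a x y} a k; first by rewrite !vmap_in stable_pos mulgVK.
rewrite terminus_opp !vmap_in stable_pos stable_opp mulgA mulgA mulVg mul1g.
by congr (_ * _).
Qed.

Lemma edge_iso_vmap a x y : edge_rel a x y ->
  edge_iso a (vmap (origin a) x) (vmap (terminus a) y).
Proof.
case=> {a x y} a k; first by rewrite !vmap_in; apply: edge_iso_pos.
by rewrite terminus_opp !vmap_in; apply: edge_iso_neg.
Qed.

Fixpoint value s w : G :=
  match w with
  | Leaf h => vmap s h
  | Node h a w' => vmap s h * stable a * value (terminus a) w'
  end.

Lemma value_act s h w : wfG s w -> value s (act S h w) = vmap s h * value s w.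
Proof.
elim: w s h => [k|k a w IHw] s h /=; first by rewrite vmapM.
case=> oa _ _ _ wfw; subst s;
  have e : _ = stable a * vmap _ (carry S a (h * k)) :=
  vmap_stable (phiP (rep_inV S a (h * k))).
by rewrite IHw // -!mulgA (mulgA (stable a)) -e !mulgA -!vmapM !mulgA mulgV
  mul1g.
Qed.

Lemma value_edge_act a w :
  value (origin a) (edge_act a w) = stable a * value (terminus a) w.
Proof.
case: edge_actP => [w' ->|_] /=; last by rewrite vmap1 mul1g.
by rewrite vmap1 mul1g terminus_opp stable_opp mulVKg.
Qed.

Lemma value_path_act s p t w : walk s p t -> all [in sub_edge T] p ->
  value s (path_act p w) = value t w.
Proof.
elim: p s => [|a p IHp] s /=; first by move/eqP->.
case/andP=> /eqP<- pt /andP[aT pT].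
by rewrite value_edge_act stable_tree // mul1g IHp.
Qed.

Lemma value_theta s t w : value s (theta s t w) = value t w.
Proof. by apply: value_path_act; [apply: tree_pathP | apply: tree_path_in]. Qed.

(** With [fg_act_value] below, this makes [value] a bijection from the normal
    forms that start and end at [s] to the fundamental group, whose inverse lets
    an element act on the trivial word. *)
Lemma value_fg_act s g w : wfG s w -> value s (fg_act s g w) = g * value s w.
Proof.
move=> wfw; rewrite -{2}(word_class_repr g) /fg_act.
elim: (repr g) => [|l u IHu] /=; first by rewrite word_class1 mul1g.
rewrite -cat1s word_class_cat -mulgA -IHu.
have wfu := wf_word_act hT u wfw; set v := word_act _ _ u w in wfu *.
have wt t := wf_theta hT t wfu.
case: l => [[t x]|[a []]] /=; rewrite value_theta.
- by rewrite value_act // value_theta vmap_in.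
- by rewrite value_edge_act value_theta.
- by rewrite value_edge_act value_theta stable_opp -stableV.
Qed.

Lemma theta_fg_act s t g z : wfG t z ->
  theta s t (fg_act t g z) = fg_act s g (theta s t z).
Proof.
move=> wfz; rewrite /fg_act; elim: (repr g) => [//|l u /= <-].
have wfu := wf_word_act hT u wfz; set v := word_act _ _ u z in wfu *.
have wt r := wf_theta hT r wfu.
case: l => [[r x]|[a b]] /=.
  rewrite !theta_comp //.
  by apply: wf_act => //; apply: supp_embed.
by rewrite !theta_comp //; apply: wf_edge_act.
Qed.

(** For [z] trivial, this shows that a normal form is determined by its value
    and its end. *)
Lemma fg_act_value r t u z : wfG t u -> wfG (endv t u) z ->
  fg_act r (value t u) (theta r (endv t u) z) = theta r t (nf_act S u z).
Proof.
elim: u t => [h|h a u IHu] t /=.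
  by move=> /suppE hE wfz; rewrite /vmap fg_act_vertex // hE.
case=> oa th _ _ wfu wfz; subst t; have wfn := wf_nf_act wfu wfz.
have wft := wf_theta hT r wfz.
rewrite fg_actM // fg_actM; last exact: wf_fg_act.
rewrite IHu // fg_act_stable // /vmap fg_act_vertex ?(suppE th) //.
exact: wf_edge_act.
Qed.

Lemma wf_one s : wfG s (Leaf _ 1).
Proof. exact: supp1. Qed.

Lemma value_one s : value s (Leaf _ 1) = 1.
Proof. exact: vmap1. Qed.

Lemma fg_act_vertex_id s (x : vgroup s) w : wfG s w ->
  fg_act s (vertex_map T x) w = act S (embed x) w.
Proof.
move=> wfw; rewrite -{1}(theta_id hT wfw) fg_act_vertex // theta_id //.
by apply: wf_act => //; apply: supp_embed.
Qed.

(** The element [x] can be recovered from its action on the trivial word. *)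
Lemma vertex_map_inj s : injective (vertex_map T (s := s)).
Proof.
move=> x y xy; have := fg_act_vertex_id x (wf_one s).
rewrite xy fg_act_vertex_id /=; last exact: wf_one.
by case=> /mulIg/embed_inj->.
Qed.

Lemma dist0_value s w z : wfG s w -> wfG s z -> dist w z = 0%N ->
  exists2 v, vertex_subgroup T (endv s w) v & value s z = value s w * v.
Proof.
elim: w s z => [h|h a w IHw] s [k|k b z] //= wfw wfz; rewrite /dist /=.
- by move=> _; exists (vmap s (h^-1 * k));
    [apply: vmap_sub | rewrite -vmapM mulVKg].
- case: ifP => [/andP[/eqP<- /eqP ab]|_] => [d0|]; last by lia.
  subst b; case: wfw wfz => _ _ _ _ wfw [_ _ _ _ wfz].
  have [|v sv vE] := IHw _ _ wfw wfz; first by rewrite /dist; lia.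
  by exists v; rewrite ?vE ?mulgA.
Qed.

(** The normal form [w] without its last coefficient is the coset, modulo the
    vertex subgroup at the end of [w], of its value; an element that fixes this
    vertex of the tree is in the conjugate of that vertex subgroup. *)
Lemma fixed_elliptic s g w : wfG s w -> dist w (fg_act s g w) = 0%N ->
  conjugate_of (value s w) (vertex_subgroup T (endv s w)) g.
Proof.
move=> wfw /dist0_value -/(_ s wfw (wf_fg_act hT g wfw))[v sv].
by rewrite value_fg_act // => e; exists v => //; rewrite -e mulgK.
Qed.

(** Membership in an edge subgroup can be tested in the direct product because
    the vertex groups embed in the fundamental group. *)
Lemma edge_subgroup_plus_vmap a h : supp (terminus a) h ->
  edge_subgroup_plus a (vmap (terminus a) h) -> egrp S (opp a) h.
Proof.
move=> sh [x]; move E: (vmap _ _) => y ay.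
case: ay sh E => {a x y} a k.
  move=> sh /vertex_map_inj E; exists (embed (mono_o a k)).
  by rewrite -(suppE sh) E; apply: edge_rel_neg.
rewrite terminus_opp oppK => sh /vertex_map_inj E; exists (embed (mono_e a k)).
by rewrite -(suppE sh) E; apply: edge_rel_pos.
Qed.

(** * Circuits and centralizers in vertex subgroups *)

Fixpoint nf_edges w : seq (edge GG) :=
  if w is Node _ a w' then a :: nf_edges w' else [::].

Lemma size_nf_edges w : size (nf_edges w) = nsize w.
Proof. by elim: w => //= h a w ->. Qed.

Lemma walk_nf_edges s w : wfG s w -> walk s (nf_edges w) (endv s w).
Proof.
by elim: w s => [h|h a w IHw] s //= [-> _ _ _ /IHw->]; rewrite eqxx.
Qed.

Definition nf_head w : ambient GG :=
  match w with Leaf h => h | Node h _ _ => h end.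

Definition scons (A : Type) (x : A) (f : nat -> A) i :=
  if i is j.+1 then f j else x.

(** The equation [act c z = end_mul z x] says that c z = z x, so that c
    fixes the path of [z].  Letting c cross the letters of [z] one after the
    other gives the elements of the circuit: [H] lists the coefficients of [z],
    [D i] is the element met before the i-th edge and [C i] the one obtained
    after it.  The value of [D] at the length of [z] is the final [x], which
    closes the circuit.  It is reduced because a coefficient of [z] between an
    edge and its opposite is a representative other than 1, and so lies outside
    the edge group. *)
Lemma circuit_data s z c x : wfG s z -> act S c z = end_mul z x ->
  exists (D C H : nat -> G), [/\
    forall a0 i, i < nsize z -> edge_iso (nth a0 (nf_edges z) i) (D i) (C i),
    forall i, i <= nsize z ->
      vertex_subgroup T (walk_vertex s (nf_edges z) i) (H i),
    (vmap s c = H 0 * D 0 * (H 0)^-1 /\ forall i, i < nsize z ->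
      C i = H i.+1 * D i.+1 * (H i.+1)^-1),
    (D (nsize z) = vmap (endv s z) x /\ H 0 = vmap s (nf_head z)) &
    forall a0 i, i.+1 < nsize z ->
      nth a0 (nf_edges z) i.+1 = opp (nth a0 (nf_edges z) i) ->
      ~ edge_subgroup_plus (nth a0 (nf_edges z) i) (H i.+1)].
Proof.
elim: z s c => [h|h a z IHz] s c /=.
  move=> sh [e]; exists (fun=> vmap s x), (fun=> 1), (fun=> vmap s h);
    split=> //.
  - by case=> // _; exists (h s).
  - by split=> //; rewrite -vmapM -vmapV -vmapM -e mulgK.
case=> oa sh ah za wfz [rch /IHz -/(_ _ wfz)[D [C [H [Diso Hsub [cE CE] [DE HE]
  red]]]]].
subst s; have := phiP (rep_inV S a (c * h)); rewrite rch => /= rel.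
exists (scons (vmap (origin a) (h^-1 * (c * h))) D).
exists (scons (vmap (terminus a) (carry S a (c * h))) C),
  (scons (vmap (origin a) h) H).
split.
- move=> a0 [_|i] /=; last exact: Diso.
  by apply: edge_iso_vmap; rewrite /carry rch.
- case=> [_|i]; first exact: vmap_sub.
  rewrite ltnS => iz /=.
  have := Hsub i iz; rewrite /walk_vertex /=; case: i iz => [//|i] iz /=.
  by rewrite !(nth_map a) ?size_nf_edges //= (set_nth_default a).
- split; first by rewrite /= -vmapM -vmapV -vmapM mulVKg mulgK.
  by case=> [_ //|i]; rewrite ltnS => /CE.
- by [].
- move=> a0 [|i]; rewrite /= ltnS; last exact: red.
  move=> z0 zE; rewrite HE => /edge_subgroup_plus_vmap.
  case: z z0 zE za wfz {IHz Diso Hsub cE CE DE HE red} => [//|k b z] /= _ -> za.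
  case=> _ sk bk _ _ /(_ sk)/rep_eq1.
  by rewrite bk => k1; rewrite k1 !eqxx in za.
Qed.

(** For the normal form [z] of [g], the equation g u = u g becomes
    [act u z = end_mul z u], and [circuit_data] gives a reduced circuit at [u]
    of the same length as [z]. *)
Lemma centralizer_vertex (hc : without_circuit T) s u g :
  vertex_subgroup T s u -> u <> 1 -> g * u = u * g -> vertex_subgroup T s g.
Proof.
move=> su u1 gu; have [x _ xE] := su.
pose z := fg_act s g (Leaf _ 1).
have wfz : wfG s z by apply/wf_fg_act/wf_one.
have ez : endv s z = s by rewrite /z endv_fg_act.
have vz : value s z = g by rewrite value_fg_act ?value_one ?mulg1 //;
  apply: wf_one.
have fixz : act S (embed x) z = end_mul z (embed x).
  have wx : wfG s (Leaf _ (embed x)) by apply: supp_embed.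
  have wn : wfG s (nf_act S z (Leaf _ (embed x))) by apply: wf_nf_act;
    rewrite ?ez.
  rewrite -fg_act_vertex_id // xE -(nf_act_leaf _ wfz) -fg_actM -?gu;
    last exact: wf_one.
  rewrite fg_actM; last exact: wf_one.
  rewrite -xE fg_act_vertex_id /= ?mulg1; last exact: wf_one.
  have := @fg_act_value s s z _ wfz; rewrite ez => /(_ _ wx).
  by rewrite vz !theta_id.
have [D [C [H [Diso Hsub [cE CE] [DE _] red]]]] := circuit_data wfz fixz.
have [z0|zn] := posnP (nsize z).
  by rewrite -vz; case: (z) z0 => //= h _; apply: vmap_sub.
rewrite ez vmap_in xE in DE; rewrite vmap_in xE in cE.
have sz := size_nf_edges z.
have walkz : walk s (in_tuple (nf_edges z)) s by rewrite /= -{2}ez;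
  apply: walk_nf_edges.
have isoz (i : 'I_(size (nf_edges z))) :
  edge_iso (tnth (in_tuple (nf_edges z)) i) (D i) (C i).
  have a0 := tnth (in_tuple (nf_edges z)) i.
  by rewrite (tnth_nth a0); apply: Diso; rewrite -sz.
have c0 : size (nf_edges z) = 0%N -> u = H 0 * u * (H 0)^-1.
  by rewrite sz => z0; rewrite z0 in zn.
have c1 (i : 'I_(size (nf_edges z))) : i = 0%N :> nat ->
  u = H 0 * D i * (H 0)^-1.
  by move=> ->.
have c2 (i j : 'I_(size (nf_edges z))) : j = i.+1 :> nat ->
    C i = H (lift ord0 i) * D j * (H (lift ord0 i))^-1.
  by move=> ->; rewrite /= /bump /= add1n; apply: CE; rewrite -sz.
have c3 (i : 'I_(size (nf_edges z))) : i.+1 = size (nf_edges z) ->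
    let l := @ord_max (size (nf_edges z)) in C i = H l * u * (H l)^-1.
  move=> iE; have e : i.+1 = nsize z by rewrite iE.
  by have := CE i; rewrite e leqnn DE => /(_ isT)->; rewrite /= {1 2}sz.
have hP (i : 'I_(size (nf_edges z)).+1) :
    vertex_subgroup T (walk_vertex s (in_tuple (nf_edges z)) i) (H i).
  by apply: Hsub; rewrite -sz -ltnS.
pose cir := @Circuit GG T u s _ (in_tuple (nf_edges z))
  (fun i => D i) (fun i => C i) (fun i => H i) walkz isoz hP c0 c1 c2 c3.
have redc : reduced_circuit cir.
  move=> [i [j]] /=; have a0 := tnth (in_tuple (nf_edges z)) i.
  rewrite !(tnth_nth a0) /= => -[ji]; rewrite ji /bump /= add1n => e.
  by apply: red e; rewrite -sz -ji.
by have := hc s u su u1 cir redc; rewrite /trivial_circuit /= sz => z0;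
  rewrite z0 in zn.
Qed.

End Values.

(** * Integer powers and subgroups of cyclic groups *)

Section IntegerPowers.
Variable G : groupType.
Implicit Types (x y : G) (m n : int).

Lemma expgz_succ x m : expgz x (m + 1)%R = expgz x m * x.
Proof.
case: m => [m|[|m]].
- by rewrite -PoszD addn1 /= expgSr.
- by rewrite /= expg1 mulVg.
- have -> : (Negz m.+1 + 1)%R = Negz m by lia.
  by rewrite /= (expgS x m.+1) invgM mulgVK.
Qed.

Lemma expgz_pred x m : expgz x (m - 1)%R = expgz x m * x^-1.
Proof.
have -> : expgz x m = expgz x (m - 1 + 1)%R by congr expgz; lia.
by rewrite expgz_succ mulgK.
Qed.

Lemma expgzD x m n : expgz x (m + n)%R = expgz x m * expgz x n.
Proof.
elim/int_ind: n => [|n IHn|n IHn].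
- by rewrite GRing.addr0 /= mulg1.
- have -> : Posz n.+1 = (Posz n + 1)%R by lia.
  by rewrite GRing.addrA !expgz_succ IHn mulgA.
- have -> : (- Posz n.+1 = (- Posz n) - 1)%R by lia.
  by rewrite GRing.addrA !expgz_pred IHn mulgA.
Qed.

Lemma expgzN x m : expgz x (- m)%R = (expgz x m)^-1.
Proof.
by apply: (mulgI (expgz x m)); rewrite -expgzD GRing.subrr mulgV.
Qed.

Lemma expgzM x m n : expgz x (m * n)%R = expgz (expgz x m) n.
Proof.
elim/int_ind: n => [|n IHn|n IHn].
- by rewrite GRing.mulr0.
- have -> : Posz n.+1 = (Posz n + 1)%R by lia.
  by rewrite GRing.mulrDr GRing.mulr1 [LHS]expgzD IHn expgz_succ.
- have -> : (- Posz n.+1 = (- Posz n) - 1)%R by lia.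
  by rewrite GRing.mulrBr GRing.mulr1 [LHS]expgzD IHn expgz_pred (expgzN x m).
Qed.

Lemma commute_expgz x y m : commute y x -> commute y (expgz x m).
Proof.
by case: m => m yx; [|apply: commuteV]; apply: commuteX.
Qed.

Lemma expgz_conj x y m : expgz (y * x * y^-1) m = y * expgz x m * y^-1.
Proof.
elim/int_ind: m => [|n IHn|n IHn].
- by rewrite /= mulg1 mulgV.
- have -> : Posz n.+1 = (Posz n + 1)%R by lia.
  by rewrite !expgz_succ IHn !mulgA mulgVK.
- have -> : (- Posz n.+1 = (- Posz n) - 1)%R by lia.
  by rewrite !expgz_pred IHn !invgM invgK !mulgA mulgVK.
Qed.
End IntegerPowers.

Lemma int_subgroup (A : set int) : A 0%R ->
  (forall m n, A m -> A n -> A (m - n)%R) ->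
  exists2 d, A d & forall m, A m -> exists q : int, m = (d * q)%R.
Proof.
move=> A0 AB.
have AN m : A m -> A (- m)%R by move=> Am; rewrite -GRing.sub0r; apply: AB.
have AD m n : A m -> A n -> A (m + n)%R.
  by move=> Am /AN An; rewrite -[n]GRing.opprK; apply: AB.
have [[m [Am m0]]|none] := pselect (exists m, A m /\ m <> 0%R); last first.
  exists 0%R => // m Am; exists 0%R; rewrite GRing.mulr0.
  by apply: contra_notP none => m0; exists m.
have exd : exists n : nat, `[< A (Posz n.+1) >].
  case: m Am m0 => [[|m]|m] // Am _; exists m; apply/asboolP => //.
  by move/AN: Am; rewrite NegzE GRing.opprK.
have [d /asboolP Ad mind] := ex_minnP exd.
exists (Posz d.+1) => // {}m {m0}Am.
have Amul q : A (q * Posz d.+1)%R.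
  elim/int_ind: q => [|q IHq|q IHq]; first by rewrite GRing.mul0r.
    have -> : (Posz q.+1 * Posz d.+1 = Posz q * Posz d.+1 + Posz d.+1)%R by lia.
    exact: AD.
  have -> : (- Posz q.+1 * Posz d.+1 =
    - Posz q * Posz d.+1 - Posz d.+1)%R by lia.
  exact: AB.
exists (m %/ Posz d.+1)%Z.
have me := divz_eq m (Posz d.+1).
have Ar : A (m %% Posz d.+1)%Z.
  have -> : (m %% Posz d.+1)%Z = (m - (m %/ Posz d.+1)%Z * Posz d.+1)%R.
    by rewrite {2}me GRing.addrC GRing.addKr.
  exact: AB.
have r0 : (0 <= (m %% Posz d.+1)%Z)%R by apply: modz_ge0.
have rd : ((m %% Posz d.+1)%Z < Posz d.+1)%R by apply: ltz_pmod.
move: Ar r0 rd me; case: (m %% Posz d.+1)%Z => [[|r]|r] // Ar _ rd me.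
  by rewrite {1}me GRing.addr0 GRing.mulrC.
by have := mind r (asboolT Ar); lia.
Qed.

Lemma cyclic_subgroup_sub (G : groupType) (z : G) (H : set G) :
  H 1 -> (forall x y, H x -> H y -> H (x * y^-1)) ->
  exists2 y, H y & forall x, cyclic_subgroup z x -> H x -> cyclic_subgroup y x.
Proof.
move=> H1 HV.
have [||d Hd dmin] := @int_subgroup [set m | H (expgz z m)].
- by [].
- by move=> m n Hm Hn; rewrite /= expgzD expgzN; apply: HV.
exists (expgz z d) => // _ [m ->] Hm.
by have [q ->] := dmin m Hm; exists q; rewrite expgzM.
Qed.

(** * Busemann functions on a group with a four-point distance *)

Section FourPoint.
Variables (G : groupType) (D : G -> G -> nat).
Hypothesis Dxx : forall x, D x x = 0%N.
Hypothesis Dsym : forall x y, D x y = D y x.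
Hypothesis Dleft : forall g x y, D (g * x) (g * y) = D x y.
Hypothesis D4 : forall u v w z,
  D u v + D w z <= maxn (D u w + D v z) (D u z + D v w).

Lemma Dtri x y z : D x z <= D x y + D y z.
Proof. by have := D4 x z y y; rewrite Dxx (Dsym z y); lia. Qed.

(** A local-to-global principle: if g o and g^2 o continue each other without
    backtracking at one point of the orbit, they do so at all of them. *)
Lemma four_point_pow g : 0 < D 1 g -> D 1 (g * g) = (D 1 g).*2 ->
  forall n, D 1 (g ^+ n) = (n * D 1 g)%N.
Proof.
move=> g0 g2 n; set L := D 1 g in g0 g2 *.
suff : D 1 (g ^+ n) = (n * L)%N /\ D 1 (g ^+ n.+1) = (n.+1 * L)%N by case.
elim: n => [|n [IHn IHn1]]; first by rewrite expg0 Dxx expg1 mul1n.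
split=> //; case: n IHn IHn1 => [|n] IHn IHn1; first by rewrite expg2 g2; lia.
have shift m : D g (g ^+ m.+1) = D 1 (g ^+ m).
  by rewrite expgS -{1}(mulg1 g) Dleft.
have step m : D (g ^+ m) (g ^+ m.+1) = L.
  by rewrite expgSr -{1}(mulg1 (g ^+ m)) Dleft.
have := D4 1 (g ^+ n.+2) g (g ^+ n.+3).
have := Dtri 1 (g ^+ n.+2) (g ^+ n.+3).
rewrite (Dsym (g ^+ n.+2) g) !shift !step IHn IHn1 -/L; nia.
Qed.

Variable g : G.
Let L := D 1 g.
Hypothesis Lpos : 0 < L.
Hypothesis Dpow : forall n, D 1 (g ^+ n) = (n * L)%N.

(** Once n exceeds d(1, h), the geodesic from h to g^(n+1) passes through g^n,
    so that D h (g^n) - n L has reached its limit. *)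
Lemma busemann_step h n : D 1 h < n -> D h (g ^+ n.+1) = (D h (g ^+ n) + L)%N.
Proof.
move=> hn; have step : D (g ^+ n) (g ^+ n.+1) = L.
  by rewrite expgSr -{1}(mulg1 (g ^+ n)) Dleft.
have := Dtri h (g ^+ n) (g ^+ n.+1); have := Dtri 1 h (g ^+ n).
have := D4 h (g ^+ n) 1 (g ^+ n.+1).
rewrite step !Dpow (Dsym h 1) (Dsym _ 1) Dpow mulSn; nia.
Qed.

(** The limit of D h (g^n) - n L, which is attained at n = D 1 h + 1. *)
Definition busemann h : int :=
  (Posz (D h (g ^+ (D 1 h).+1)) - Posz ((D 1 h).+1 * L))%R.

Lemma busemannE h n : D 1 h < n ->
  Posz (D h (g ^+ n)) = (busemann h + Posz (n * L))%R.
Proof.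
move=> /subnK<-; elim: (n - _)%N => [|k IHk];
  first by rewrite add0n /busemann; lia.
by rewrite addSn busemann_step; [rewrite mulSn; lia | lia].
Qed.

Lemma commute_expgE h n : commute h g -> h * g ^+ n = g ^+ n * h.
Proof. exact: commuteX. Qed.

(** For n large, the four-point inequality on k, 1, g^n and g^n h^-1, where
    D k 1 and D g^n (g^n h^-1) stay bounded, forces the two other sums of
    opposite distances to be equal.  Since h commutes with g^n, the distances
    involved are D (h k) g^n, D k g^n and D h g^n. *)
Lemma busemannM h k : commute h g ->
  busemann (h * k) = (busemann h + busemann k)%R.
Proof.
(* Large enough for the three limits and for the bounded sum. *)
move=> hg; pose n := (D 1 h + D 1 k + D 1 (h * k)).+1.
have Ehk := @busemannE (h * k) n ltac:(rewrite /n; lia).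
have Eh := @busemannE h n ltac:(rewrite /n; lia).
have Ek := @busemannE k n ltac:(rewrite /n; lia).
have e1 : D (h * k) (g ^+ n) = D k (g ^+ n * h^-1).
  by rewrite -(Dleft h k) mulgA commute_expgE // mulgK.
have e2 : D 1 (g ^+ n * h^-1) = D h (g ^+ n).
  by rewrite -(Dleft h 1) mulgA commute_expgE // mulgK mulg1.
have e3 : D (g ^+ n) (g ^+ n * h^-1) = D 1 h.
  by rewrite -{1}(mulg1 (g ^+ n)) Dleft -(Dleft h) mulg1 mulgV Dsym.
have := D4 k (g ^+ n * h^-1) 1 (g ^+ n).
have := D4 k (g ^+ n) 1 (g ^+ n * h^-1).
have := Dtri 1 h (g ^+ n); have := Dtri 1 k (g ^+ n).
have nL : n <= n * L by rewrite leq_pmulr.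
rewrite (Dsym (g ^+ n * _) 1) (Dsym (g ^+ n * _) (g ^+ n)) (Dsym (g ^+ n) 1) e2
  e3.
rewrite Dpow (Dsym k 1); move: Ehk; rewrite e1; move: (nL); rewrite {1}/n; lia.
Qed.

Lemma busemann_self : busemann g = (- Posz L)%R.
Proof.
have := @busemannE g L.+1 (leqnn _);
  rewrite expgS -{1}(mulg1 g) Dleft Dpow mulSn.
lia.
Qed.

Lemma busemann1 : busemann 1 = 0%R.
Proof.
by have := @busemannM 1 1 (commute_sym (commute1 g)); rewrite mulg1; lia.
Qed.

Lemma busemannV h : commute h g -> busemann h^-1 = (- busemann h)%R.
Proof.
by move=> hg; have := busemannM h^-1 hg; rewrite mulgV busemann1; lia.
Qed.

Lemma busemann_expgz h m : commute h g ->
  busemann (expgz h m) = (busemann h * m)%R.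
Proof.
move=> hg; elim/int_ind: m => [|n IHn|n IHn].
- by rewrite /= busemann1 GRing.mulr0.
- have -> : Posz n.+1 = (Posz n + 1)%R by lia.
  rewrite expgz_succ busemannM ?IHn; first by lia.
  exact/commute_sym/commute_expgz/commute_sym.
- have -> : (- Posz n.+1 = (- Posz n) - 1)%R by lia.
  rewrite expgz_pred busemannM ?IHn; first by rewrite busemannV //; lia.
  exact/commute_sym/commute_expgz/commute_sym.
Qed.

(** Such an h is at distance n L from both g^n and g^-n, which are at distance
    2 n L from each other, as is 1: both are the midpoint. *)
Lemma busemann_ker h : commute h g -> busemann h = 0%R -> D 1 h = 0%N.
Proof.
move=> hg h0; pose n := (D 1 h + D 1 h^-1).+1.
have Eh := @busemannE h n ltac:(rewrite /n; lia).
have EV := @busemannE h^-1 n ltac:(rewrite /n; lia).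
rewrite busemannV // h0 in EV; rewrite h0 in Eh.
have e1 : D h (g ^- n) = D h^-1 (g ^+ n).
  rewrite -(Dleft (g ^+ n) h) mulgV -commute_expgE // -(Dleft h h^-1) mulgV.
  exact: Dsym.
have e2 : D (g ^+ n) (g ^- n) = ((n + n) * L)%N.
  by rewrite -(Dleft (g ^+ n)) mulgV -expgnDr Dsym Dpow.
have e3 : D 1 (g ^- n) = (n * L)%N.
  by rewrite -(Dleft (g ^+ n)) mulgV mulg1 Dsym Dpow.
have := D4 1 h (g ^+ n) (g ^- n); rewrite e1 e2 e3 Dpow mulnDl; lia.
Qed.

Hypothesis free : forall h, commute h g -> D 1 h = 0%N -> h = 1.

(** The Busemann function embeds the centralizer in the integers, and its image
    contains - L <> 0. *)
Lemma infinite_cyclic_centralizer : infinite_cyclic (centralizer g).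
Proof.
have [||d [z zg dE] dmin] :=
  @int_subgroup [set m | exists2 h, commute h g & busemann h = m].
- by exists 1; [apply/commute_sym/commute1 | apply: busemann1].
- move=> m n [h hg <-] [k kg <-]; exists (h * k^-1).
    by apply/commute_sym/commuteM; [|apply: commuteV]; apply: commute_sym.
  by rewrite busemannM // busemannV.
have d0 : d <> 0%R.
  move=> d0; have [|q] := dmin (busemann g); first by exists g.
  by rewrite busemann_self d0; lia.
exists z.
  move=> m n /(congr1 busemann);
    rewrite !busemann_expgz // dE => /(GRing.mulfI _)->//.
  exact/eqP.
apply/seteqP; split=> [h hg|_ [m ->]];
  last exact/commute_sym/commute_expgz/commute_sym.
have [|q qE] := dmin (busemann h); first by exists h.
exists q; apply/divg1_eq/free.
  apply/commute_sym/commuteM; first exact/commute_sym.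
  exact/commuteV/commute_expgz/commute_sym.
apply: busemann_ker.
  apply/commute_sym/commuteM; first exact/commute_sym.
  exact/commuteV/commute_expgz/commute_sym.
have zq : commute (expgz z q) g by exact/commute_sym/commute_expgz/commute_sym.
by rewrite busemannM // busemannV // busemann_expgz // dE qE GRing.subrr.
Qed.
End FourPoint.

(** * Elliptic and hyperbolic elements *)

Section Elliptic.
Variables (GG : graph_of_groups) (T : subgraph GG).
Hypothesis hT : maximal_tree T.

Local Notation S := (vertex_system GG).
Local Notation G := (fundamental_group T).
Local Notation nfG := (nf GG (ambient GG)).
Local Notation wfG := (wf S).
Local Notation theta := (theta hT).
Local Notation fg_act := (fg_act hT).
Local Notation o := (Leaf GG (1 : ambient GG)).

Definition elliptic (g : G) : Prop :=
  exists (s : vertex GG) (y : G), conjugate_of y (vertex_subgroup T s) g.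

(** If k minimises the displacement at the base point o, the geodesics from o to
    k o and to k^-1 o leave o through different edges.  Otherwise let z be the
    next vertex on both.  The four-point inequality shows that k moves z
    less than it moves o, unless the displacement is 1; in that case k would
    map z to o and o to z, but the edge a from o to z is sent by k to an edge
    of the same type a, which cannot be its opposite. *)
Lemma axis_turn s (k : G) :
  0 < dist o (fg_act s k o) ->
  (forall z, wfG s z -> dist o (fg_act s k o) <= dist z (fg_act s k z)) ->
  dist o (fg_act s (k * k) o) = (dist o (fg_act s k o)).*2.
Proof.
have wo := wf_one s; have wfk g := wf_fg_act hT g wo.
set p := fg_act s k o; set q := fg_act s k^-1 o => L0 Lmin.
have distk g w z := dist_fg_act hT g (w := w) (z := z) (s0 := s).
have qo : dist o q = dist o p.
  by rewrite -(distk k o q wo (wfk _)) /q -fg_actM // mulgV fg_act1 // distC.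
have qp : dist q p = dist o (fg_act s (k * k) o).
  by rewrite -(distk k q p (wfk _) (wfk _)) /q -fg_actM // mulgV fg_act1 //
    fg_actM.
have pq := distE q p; rewrite !dist_leaf in qo qp L0 Lmin *.
have [l0|] := posnP (lcp q p); first by rewrite -qp -addnn -{1}qo -pq l0 addn0.
have wp := wfk k; have wq := wfk k^-1;
  have ep : endv s p = s by rewrite /p endv_fg_act.
have vp : value T s p = k by rewrite value_fg_act // value_one mulg1.
move: wp wq ep vp qo qp L0 Lmin pq; rewrite -/p -/q.
case pE : p => [//|h a p']; case qE : q => [//|h' a' q'] /=.
case: ifP => // /andP[/eqP hh' /eqP aa'] wp wq ep vp [qo] qp _ Lmin _ _;
  subst h' a'.
pose z : nfG := Node h a o.
have wz : wfG s z.
  by case: wp => oa sh ah _ _; split=> //; apply: wf_one.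
have zp : dist z p = nsize p' by rewrite pE /dist /= !eqxx;
  case: (p') => [//|? ? ?] /=; lia.
have zq : dist z q = nsize q' by rewrite qE /dist /= !eqxx;
  case: (q') => [//|? ? ?] /=; lia.
have zo : dist z o = 1%N by [].
have kzp : dist (fg_act s k z) p = 1%N by rewrite distk.
have kzo : dist (fg_act s k z) o = nsize q'.
  rewrite -zq -(distk k z q) //; last exact: wfk.
  by rewrite /q -fg_actM // mulgV fg_act1.
have := dist4 z (fg_act s k z) o p; rewrite zo kzp zp kzo dist_leaf.
have := Lmin z wz; rewrite [in nsize p]pE /= qo => Lz D.
(* Only displacement 1 is left: the inequality reads 2 L <= max 2 (2 L - 2). *)
have p0 : nsize p' = 0%N by lia.
have kz : fg_act s k z = nf_act S p z.
  have wp' : wfG s p by exact: wfk.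
  have ep' : endv s p = s by rewrite pE.
  have := @fg_act_value GG T hT s s p z wp'; rewrite ep' => /(_ wz).
  rewrite !theta_id // ?pE /= ?vp //.
  by rewrite -/(nf_act S (Node h a p') z) -pE; apply: wf_nf_act; rewrite ?ep'.
move: kzo; rewrite distC dist_leaf kz pE qo p0 /=.
by case: (p') p0 => //= c _; rewrite nsize_act opp_neqF andbF.
Qed.

Hypothesis hc : without_circuit T.

Lemma elliptic_centralizer s (y g x : G) : g <> 1 ->
  conjugate_of y (vertex_subgroup T s) g -> commute x g ->
  conjugate_of y (vertex_subgroup T s) x.
Proof.
move=> g1 [u su gE] xg; exists (y^-1 * x * y); last first.
  by rewrite !mulgA mulgV mul1g mulgK.
apply: (centralizer_vertex hT hc su); first by move=> u1; apply: g1;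
  rewrite gE u1 mulg1 mulgV.
have uE : u = y^-1 * g * y by rewrite gE !mulgA mulVg mul1g mulgVK.
by rewrite uE !mulgA !mulgK -(mulgA y^-1 x g) xg mulgA.
Qed.

(** A normal form [w] minimising d(w, g w) is moved to the trivial word by
    changing the base vertex to the end of [w] and conjugating by the value of
    [w], by means of the isometry [Psi]; [axis_turn] then applies.  An element h
    of the centralizer that fixes [w] is elliptic, and h <> 1 would make g
    elliptic too. *)
Lemma hyperbolic_centralizer (g : G) : ~ elliptic g ->
  infinite_cyclic (centralizer g).
Proof.
move=> hyp; have [[s0 _] _ _] := proj1 hT.
have exL : exists n, `[< exists2 w, wfG s0 w & dist w (fg_act s0 g w) = n >].
  by exists (dist o (fg_act s0 g o)); apply/asboolP; exists o => //;
    apply: wf_one.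
have [L /asboolP[w wfw wL] minL] := ex_minnP exL.
have L0 : 0 < L.
  rewrite lt0n; apply/eqP => L0; apply: hyp.
  by exists (endv s0 w), (value T s0 w); apply: (fixed_elliptic wfw);
    rewrite wL.
pose s := endv s0 w; pose y := value T s0 w; pose k := y^-1 * g * y.
(* It sends the trivial word to w and conjugates k to g. *)
pose Psi z := fg_act s0 y (theta s0 s z).
have wfPsi z : wfG s z -> wfG s0 (Psi z) by move=> wz; apply/wf_fg_act/wf_theta.
have Psi1 : Psi o = w.
  have wo := wf_one s.
  by rewrite /Psi (fg_act_value hT s0 wfw wo) (nf_act_leaf1 wfw) theta_id.
have Psik h z : wfG s z ->
  Psi (fg_act s (y^-1 * h * y) z) = fg_act s0 h (Psi z).
  move=> wz; rewrite /Psi theta_fg_act // -!fg_actM; try exact: wf_theta.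
  by rewrite !mulgA mulgV mul1g.
have distPsi z z' : wfG s z -> wfG s z' -> dist (Psi z) (Psi z') = dist z z'.
  by move=> wz wz'; rewrite dist_fg_act ?dist_theta //; apply: wf_theta.
have wo := wf_one s;
  have distw h : dist w (fg_act s0 h w) = dist o (fg_act s (y^-1 * h * y) o).
  by rewrite -{1 2}Psi1 -Psik // distPsi //; apply: wf_fg_act.
have turn : dist w (fg_act s0 (g * g) w) = L.*2.
  rewrite distw.
  have -> : y^-1 * (g * g) * y = k * k by rewrite /k !mulgA mulgK.
  rewrite axis_turn; rewrite -?distw ?wL //.
  move=> z wz; rewrite -distPsi // ?Psik //; last exact: wf_fg_act.
  by apply: minL; apply/asboolP; exists (Psi z) => //; apply: wfPsi.
pose D (x z : G) := dist (fg_act s0 x w) (fg_act s0 z w).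
have D1 x : D 1 x = dist w (fg_act s0 x w) by rewrite /D fg_act1.
have Dleft h x z : D (h * x) (h * z) = D x z.
  by rewrite /D !fg_actM // dist_fg_act //; apply: wf_fg_act.
have D4 u v x z : D u v + D x z <= maxn (D u x + D v z) (D u z + D v x).
  exact: dist4.
have Dxx x : D x x = 0%N by apply: distxx.
have Dsym x z : D x z = D z x by apply: distC.
apply: (infinite_cyclic_centralizer (D := D)) => //.
- by rewrite D1 wL.
- apply: four_point_pow => //; rewrite !D1 ?turn ?wL //.
- move=> h hg; rewrite D1 => /(fixed_elliptic wfw) hell.
  have [//|h1] := pselect (h = 1); case: hyp; exists s, y.
  exact: elliptic_centralizer h1 hell (commute_sym hg).
Qed.
End Elliptic.

Lemma is_root_commute (G : groupType) (x g : G) : is_root x g -> commute x g.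
Proof. by case=> n _ <-; apply: commute_expgz. Qed.

(** * Roots in the fundamental group and in the vertex groups *)

Section Roots.
Variables (GG : graph_of_groups) (T : subgraph GG).
Hypothesis hT : maximal_tree T.
Hypothesis hc : without_circuit T.

Lemma vertex_map_expgz s (x : vgroup s) n :
  vertex_map T (expgz x n) = expgz (vertex_map T x) n.
Proof.
have vX m : vertex_map T (x ^+ m) = vertex_map T x ^+ m.
  by elim: m => [|m IHm]; rewrite ?vertex_map1 // !expgS vertex_mapM IHm.
by case: n => m /=; rewrite ?vertex_mapV vX.
Qed.

Lemma vertex_is_root s (x g : vgroup s) :
  is_root (vertex_map T x) (vertex_map T g) <-> is_root x g.
Proof.
split=> [[n n0 e]|[n n0 <-]]; exists n => //; last by rewrite vertex_map_expgz.
by move: e; rewrite -vertex_map_expgz => /(vertex_map_inj hT).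
Qed.

(** A generator in the fundamental group need not lie in the vertex subgroup;
    the part of its cyclic group inside the vertex subgroup is again cyclic. *)
Lemma vertex_roots s (g : vgroup s) :
  roots_in_cyclic (vertex_map T g) -> roots_in_cyclic g.
Proof.
case=> z zroot.
have [||_ [y _ <-] ysub] := @cyclic_subgroup_sub _ z (vertex_subgroup T s).
- by exists 1 => //; apply: vertex_map1.
- by move=> _ _ [a _ <-] [b _ <-]; exists (a * b^-1);
    rewrite ?vertex_mapM ?vertex_mapV.
exists y => x /vertex_is_root xg.
have [|m] := ysub (vertex_map T x) (zroot _ xg); first by exists x.
by rewrite -vertex_map_expgz => /(vertex_map_inj hT) ->; exists m.
Qed.

Lemma roots_neq1 :
  (forall s : vertex GG, trivial_root_structure_neq1 (vgroup s)) ->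
  trivial_root_structure_neq1 (fundamental_group T).
Proof.
move=> srt g g1; have [[s [y gell]]|hyp] := pselect (elliptic g); last first.
  have [z _ zE] := hyperbolic_centralizer hT hc hyp.
  by exists z => x /is_root_commute xg; rewrite -zE.
have [_ [h _ <-] gE] := gell.
have h1 : h <> 1 by move=> h1; apply: g1; rewrite gE h1 vertex_map1 mulg1 mulgV.
have [z zroot] := srt s h h1; exists (y * vertex_map T z * y^-1) => x xg.
have [_ [x' _ <-] xE] :=
  elliptic_centralizer hT hc g1 gell (is_root_commute xg).
have [|m mE] := zroot x'.
  apply/vertex_is_root; case: xg => n n0; rewrite xE gE expgz_conj.
  by move=> /mulIg/mulgI e; exists n.
by exists m; rewrite xE expgz_conj mE vertex_map_expgz.
Qed.

Lemma torsion_free_expgz (G : groupType) (x : G) n : torsion_free G ->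
  n <> Posz 0 -> expgz x n = 1 -> x = 1.
Proof.
move=> tf; case: n => [[|n]|n] // _ /= xn; first exact: tf xn.
by apply: (tf _ n.+1) => //; rewrite -[LHS]invgK xn invg1.
Qed.

Lemma torsion_free_fundamental_group :
  (forall s : vertex GG, torsion_free (vgroup s)) ->
  forall x : fundamental_group T, is_root x 1 -> x = 1.
Proof.
move=> tf x [n n0 xn]; have [//|x1] := pselect (x = 1).
have [[s [y [_ [x' _ <-] xE]]]|hyp] := pselect (elliptic x).
  move: xn; rewrite xE expgz_conj => /divg1_eq; rewrite -{2}(mulg1 y) => /mulgI.
  rewrite -vertex_map_expgz -(vertex_map1 T s) => /(vertex_map_inj hT) x'1.
  by rewrite (torsion_free_expgz (tf s) n0 x'1) vertex_map1 mulg1 mulgV.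
have [z zinj zE] := hyperbolic_centralizer hT hc hyp.
have [k xk] : cyclic_subgroup z x by rewrite -zE.
have : expgz z (k * n)%R = expgz z 0%R by rewrite expgzM -xk xn.
move=> /zinj/eqP; rewrite GRing.mulf_eq0 => /orP[/eqP k0|/eqP//].
by rewrite xk k0.
Qed.
End Roots.

Theorem mainTheorem10 (GG : graph_of_groups) (T : subgraph GG)
    (hT : maximal_tree T) (hc : without_circuit T) :
  [/\ forall g x : fundamental_group T, g <> 1 -> x <> 1 -> is_root x g ->
        (exists (s : vertex GG) (y : fundamental_group T),
           conjugate_of y (vertex_subgroup T s) x /\
           conjugate_of y (vertex_subgroup T s) g) \/
        (centralizer g x /\ infinite_cyclic (centralizer g)),
      trivial_root_structure_neq1 (fundamental_group T) <->
        (forall s : vertex GG, trivial_root_structure_neq1 (vgroup s)),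
      trivial_root_structure (fundamental_group T) ->
        (forall s : vertex GG, trivial_root_structure (vgroup s))
    & (forall s : vertex GG, torsion_free (vgroup s)) ->
        (trivial_root_structure (fundamental_group T) <->
         (forall s : vertex GG, trivial_root_structure (vgroup s)))].
Proof.
have srtV : trivial_root_structure (fundamental_group T) ->
    forall s : vertex GG, trivial_root_structure (vgroup s).
  by move=> srt s g; apply: (vertex_roots hT).
split=> //.
- move=> g x g1 _ /is_root_commute xg.
  have [[s [y gell]]|hyp] := pselect (elliptic g); last first.
    by right; split=> //; apply: hyperbolic_centralizer.
  by left; exists s, y; split=> //; apply: (elliptic_centralizer hT hc g1 gell).
- split=> [srt s g g1|]; last exact: roots_neq1.
  apply: (vertex_roots hT); apply: srt => g1'; apply: g1.
  by apply: (vertex_map_inj hT); rewrite g1' vertex_map1.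
- move=> tf; split=> // srt g; have [->|g1] := pselect (g = 1); last first.
    by apply: roots_neq1 => // s h _; apply: srt.
  exists 1 => x /(torsion_free_fundamental_group hT hc tf) ->.
  by exists 0%R.
Qed.
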